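(* Let $R$ be a ring, $X$ a connective $R^{\mathrm{op}}$-complex, and $Y$ a connective $R$-complex. Then there exists a quasi-isomorphism $\nabla^{X,Y}:X\otimes_{R}Y\rightarrow X\boxtimes_{R}Y$ of $\mathbb{Z}$-complexes which is natural in $X$ and $Y$, where $X\boxtimes_R Y$ is the shuffle product.
   Context: An $R$-complex is a chain complex of left $R$-modules, an $R^{\mathrm{op}}$-complex is a chain complex of right $R$-modules; a complex $X$ is connective if $X_i=0$ for $i<0$. $X\otimes_R Y$ is the usual tensor product complex, with $(X\otimes_RY)_n=\bigoplus_{k+l=n}X_k\otimes_RY_l$ and $\partial(x\otimes y)=\partial(x)\otimes y+(-1)^{k}x\otimes\partial(y)$ for $x\in X_k$. $\Delta$ is the category with objects $[n]=\{0,1,\dots,n\}$, $n\ge 0$, and order-preserving maps; $\delta_{n,i}:[n-1]\to[n]$ is the injective order-preserving map missing $i$. For a simplicial module $M$ (contravariant functor from $\Delta$ to modules), $d^M_{n,i}=M(\delta_{n,i})$. Dold-Kan functor: for a connective complex $X$, $\operatorname{DK}(X)$ is the simplicial module with $\operatorname{DK}(X)([n])=\bigoplus_{f:[n]\to[k]\text{ surjective in }\Delta}X_{k}$. For $\eta:[n]\to[m]$ in $\Delta$, the map $\operatorname{DK}(X)(\eta):\operatorname{DK}(X)([m])\to\operatorname{DK}(X)([n])$ has matrix entries $\operatorname{DK}(X)(\eta)_{f,g}:X_l\to X_k$ (for surjections $g:[m]\to[l]$, $f:[n]\to[k]$) given as follows: if $g\eta=\iota f$ is the unique factorization of $g\eta$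 with $\iota:[k]\to[l]$ injective and $f$ surjective, the entry is $1^{X_l}$ if $k=l$ (so $\iota=1^{[l]}$), is $(-1)^{l}\partial_l^X$ if $k=l-1$ and $\iota=\delta_{l,l}$, and is $0$ otherwise; all entries $(f,g)$ with $f$ not the surjective part of $g\eta$ are $0$. Let $\lambda_f^X:X_k\to\operatorname{DK}(X)([n])$ be the canonical injection at index $f$. Shuffle product: for $n\ge0$ let $\mathcal{S}_n$ be the set of pairs $(f,g)$ of surjections $f:[n]\to[k]$, $g:[n]\to[l]$ in $\Delta$ with $0\le k,l\le n$ such that $\phi_{f,g}:[n]\to[k]\times[l]$, $i\mapsto(f(i),g(i))$, is injective. Set $(X\boxtimes_RY)_n=\bigoplus_{(f,g)\in\mathcal{S}_n}(X_k\otimes_RY_l)$, with canonical injections $\lambda_{f,g}^{X,Y}$. This is regarded as a direct summand of $\operatorname{DK}(X)([n])\otimes_R\operatorname{DK}(Y)([n])=\bigoplus_{(f,g)}X_k\otimes_RY_l$ (sum over all pairs of surjections), so that $\lambda_{f,g}^{X,Y}(x\otimes y)=\lambda_f^X(x)\otimes\lambda_g^Y(y)$. The differential is $$\partial_n^{X\boxtimes_RY}(\lambda_{f,g}^{X,Y}(x\otimes y))=\sum_{i=0}^n(-1)^i d_{n,i}^{\operatorname{DK}(X)}(\lambda_f^X(x))\otimes d_{n,i}^{\operatorname{DK}(Y)}(\lambda_g^Y(y)),$$ which makes $X\boxtimes_RY$ a connective $\mathbb{Z}$-complex. It is functorial in each variable: for morphisms $\eta:X\to X'$ and $\theta:Y\to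 Y'$, $(\eta\boxtimes_RY)_n(\lambda_{f,g}^{X,Y}(x\otimes y))=\lambda_{f,g}^{X',Y}(\eta_k(x)\otimes y)$ and $(X\boxtimes_R\theta)_n(\lambda_{f,g}^{X,Y}(x\otimes y))=\lambda_{f,g}^{X,Y'}(x\otimes\theta_l(y))$. *)

(* Defs.v *)
From HB Require Import structures.
From mathcomp Require Import all_boot all_algebra.
From mathcomp Require Import generic_quotient ring_quotient boolp freeg zify.

Set Implicit Arguments.
Unset Strict Implicit.
Unset Printing Implicit Defensive.

Import GRing.Theory.
Import Quotient.Exports.

Local Open Scope ring_scope.
Local Open Scope quotient_scope.

(* A right R-module is a left module over the converse ring R^c, so that      *)
(* x r is written (r : R^c) *: x.                                             *)

Section TensorProduct.

Variables (R : pzRingType) (M : lmodType R^c) (N : lmodType R).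

Inductive tens_rel : {freeg (M * N)%type} -> Prop :=
| tens_rel0 : tens_rel 0
| tens_relB u v : tens_rel u -> tens_rel v -> tens_rel (u - v)
| tens_relDl x x' y :
    tens_rel (<< (x + x', y) >> - (<< (x, y) >> + << (x', y) >>))
| tens_relDr x y y' :
    tens_rel (<< (x, y + y') >> - (<< (x, y) >> + << (x, y') >>))
| tens_relZ x (r : R) y :
    tens_rel (<< ((r : R^c) *: x, y) >> - << (x, r *: y) >>).

Definition tens_ker : {pred {freeg (M * N)%type}} := fun u => `[< tens_rel u >].

Fact tens_ker_zmod_closed : zmod_closed tens_ker.
Proof.
split; first by apply/asboolP; exact: tens_rel0.
by move=> u v /asboolP ku /asboolP kv; apply/asboolP; exact: tens_relB.
Qed.

HB.instance Definition _ :=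
  GRing.isZmodClosed.Build {freeg (M * N)%type} tens_ker tens_ker_zmod_closed.

Definition tens : zmodType := Quotient.quot tens_ker.

Definition tens_pi (u : {freeg (M * N)%type}) : tens :=
  \pi_(Quotient.quot tens_ker) u.

Fact tens_pi_is_zmod_morphism : zmod_morphism tens_pi.
Proof. by move=> u v; rewrite /tens_pi raddfB. Qed.

HB.instance Definition _ :=
  GRing.isZmodMorphism.Build {freeg (M * N)%type} tens tens_pi
    tens_pi_is_zmod_morphism.

Definition tensor (x : M) (y : N) : tens := tens_pi << (x, y) >>.

Lemma tens_pi_eq0 u : tens_rel u -> tens_pi u = 0.
Proof.
move=> ku; rewrite -[RHS](raddf0 tens_pi); apply/eqP.
by rewrite /tens_pi -Quotient.idealrBE subr0; apply/asboolP.
Qed.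

Lemma tens_pi_eqP u v : tens_pi u = tens_pi v -> tens_rel (u - v).
Proof.
by move=> /eqP; rewrite /tens_pi -Quotient.idealrBE => /asboolP.
Qed.

Lemma tensorDl x x' y : tensor (x + x') y = tensor x y + tensor x' y.
Proof.
apply/eqP; rewrite -subr_eq0 /tensor -raddfD -raddfB /=.
by rewrite tens_pi_eq0 //; exact: tens_relDl.
Qed.

Lemma tensorDr x y y' : tensor x (y + y') = tensor x y + tensor x y'.
Proof.
apply/eqP; rewrite -subr_eq0 /tensor -raddfD -raddfB /=.
by rewrite tens_pi_eq0 //; exact: tens_relDr.
Qed.

Lemma tensorZ x (r : R) y : tensor ((r : R^c) *: x) y = tensor x (r *: y).
Proof.
apply/eqP; rewrite -subr_eq0 /tensor -raddfB /=.
by rewrite tens_pi_eq0 //; exact: tens_relZ.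
Qed.

Lemma tens_ind (P : tens -> Prop) :
    (forall u v, P u -> P v -> P (u - v)) ->
    (forall x y, P (tensor x y)) -> forall t, P t.
Proof.
move=> PB Pt t.
have P0 : P 0 by rewrite -(subrr (tensor 0 0)); apply: PB.
have PN u : P u -> P (- u) by move=> Pu; rewrite -[- u]add0r; apply: PB.
have PD u v : P u -> P v -> P (u + v).
  by move=> Pu Pv; rewrite -[v]opprK; apply: PB => //; apply: PN.
have -> : t = tens_pi (repr t) by rewrite /tens_pi reprK.
rewrite -[repr t]freeg_sumE raddf_sum /=; elim/big_ind: _ => // -[x y] _.
rewrite -[coeff _ _]intz -freegU_mulz raddfMz /= -/(tensor x y).
have PMn n : P (tensor x y *+ n).
  by elim: n => [|n IHn]; rewrite ?mulr0n ?mulrS //; apply: PD.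
by case: (coeff _ _) => n; rewrite ?NegzE ?mulrNz -pmulrn //; apply: PN.
Qed.

Lemma eq_tens (A : zmodType) (f g : {additive tens -> A}) :
  (forall x y, f (tensor x y) = g (tensor x y)) -> f =1 g.
Proof.
by move=> fg; apply: tens_ind => // u v fu fv; rewrite !raddfB fu fv.
Qed.

Section Lift.

Variables (A : zmodType) (b : M -> N -> A).

Record balanced : Prop := Balanced {
  balancedDl : forall x x' y, b (x + x') y = b x y + b x' y;
  balancedDr : forall x y y', b x (y + y') = b x y + b x y';
  balancedZ : forall x (r : R) y, b ((r : R^c) *: x) y = b x (r *: y)
}.

Definition freeg_lift (u : {freeg (M * N)%type}) : A :=
  fglift (fun p => b p.1 p.2 : zmodule A) u.

Fact freeg_lift_is_zmod_morphism : zmod_morphism freeg_lift.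
Proof. by move=> u v; rewrite /freeg_lift lift_is_additive. Qed.

HB.instance Definition _ :=
  GRing.isZmodMorphism.Build {freeg (M * N)%type} A freeg_lift
    freeg_lift_is_zmod_morphism.

Lemma freeg_liftU p : freeg_lift << p >> = b p.1 p.2.
Proof. by rewrite /freeg_lift liftU scale1r. Qed.

Definition tens_lift (_ : balanced) (t : tens) : A := freeg_lift (repr t).

Hypothesis bb : balanced.

Lemma tens_lift_pi u : tens_lift bb (tens_pi u) = freeg_lift u.
Proof.
rewrite /tens_lift; set v := repr _.
have uv : tens_rel (v - u).
  by apply: tens_pi_eqP; rewrite /tens_pi /v reprK.
apply/eqP; rewrite -subr_eq0 -raddfB /=; apply/eqP.
elim: uv => [|w w' _ IH _ IH'|x x' y|x y y'|x r y].
- by rewrite raddf0.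
- by rewrite raddfB /= IH IH' subrr.
- by rewrite raddfB raddfD /= !freeg_liftU /= (balancedDl bb) subrr.
- by rewrite raddfB raddfD /= !freeg_liftU /= (balancedDr bb) subrr.
- by rewrite raddfB /= !freeg_liftU /= (balancedZ bb) subrr.
Qed.

Lemma tens_lift_tensor x y : tens_lift bb (tensor x y) = b x y.
Proof. by rewrite tens_lift_pi freeg_liftU. Qed.

Fact tens_lift_is_zmod_morphism : zmod_morphism (tens_lift bb).
Proof.
move=> s t; have -> : s = tens_pi (repr s) by rewrite /tens_pi reprK.
have -> : t = tens_pi (repr t) by rewrite /tens_pi reprK.
by rewrite -raddfB !tens_lift_pi raddfB.
Qed.

HB.instance Definition _ :=
  GRing.isZmodMorphism.Build tens A (tens_lift bb) tens_lift_is_zmod_morphism.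

End Lift.

End TensorProduct.

Section TensorMap.

Variables (R : pzRingType).

Fact tensor_map_balanced (M M' : lmodType R^c) (N N' : lmodType R)
    (f : {linear M -> M'}) (g : {linear N -> N'}) :
  balanced (fun x y => tensor (f x) (g y)).
Proof.
by split=> [x x' y|x y y'|x r y];
  rewrite ?linearD ?linearZ ?tensorDl ?tensorDr //= tensorZ.
Qed.

Definition tens_map (M M' : lmodType R^c) (N N' : lmodType R)
    (f : {linear M -> M'}) (g : {linear N -> N'}) (t : tens M N) :
    tens M' N' :=
  tens_lift (tensor_map_balanced f g) t.

Fact tens_map_is_zmod_morphism (M M' : lmodType R^c) (N N' : lmodType R)
    (f : {linear M -> M'}) (g : {linear N -> N'}) :
  zmod_morphism (tens_map f g).
Proof. by move=> s t; rewrite /tens_map raddfB. Qed.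

HB.instance Definition _ (M M' : lmodType R^c) (N N' : lmodType R)
    (f : {linear M -> M'}) (g : {linear N -> N'}) :=
  GRing.isZmodMorphism.Build (tens M N) (tens M' N') (tens_map f g)
    (tens_map_is_zmod_morphism f g).

Lemma tens_map_tensor (M M' : lmodType R^c) (N N' : lmodType R)
    (f : {linear M -> M'}) (g : {linear N -> N'}) x y :
  tens_map f g (tensor x y) = tensor (f x) (g y).
Proof. exact: tens_lift_tensor. Qed.

End TensorMap.

Section TensorFacts.

Variables (R : pzRingType) (M : lmodType R^c) (N : lmodType R).

Lemma tensor0l y : tensor 0 y = 0 :> tens M N.
Proof. by apply: (addrI (tensor 0 y)); rewrite -tensorDl !addr0. Qed.

Lemma tensor0r x : tensor x 0 = 0 :> tens M N.
Proof. by apply: (addrI (tensor x 0)); rewrite -tensorDr !addr0. Qed.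

End TensorFacts.

Section TensorMapFacts.

Variables (R : pzRingType) (M M' M'' : lmodType R^c) (N N' N'' : lmodType R).
Implicit Types (t : tens M N).

Lemma eq_tens_map (f f' : {linear M -> M'}) (g g' : {linear N -> N'}) :
  f =1 f' -> g =1 g' -> tens_map f g =1 tens_map f' g'.
Proof.
by move=> ff' gg'; apply: eq_tens => x y /=; rewrite !tens_map_tensor ff' gg'.
Qed.

Lemma tens_map_comp (f : {linear M' -> M''}) (g : {linear N' -> N''})
    (f' : {linear M -> M'}) (g' : {linear N -> N'}) t :
  tens_map f g (tens_map f' g' t) = tens_map (f \o f') (g \o g') t.
Proof.
move: t; apply: (eq_tens (f := tens_map f g \o tens_map f' g')) => x y /=.
by rewrite !tens_map_tensor.
Qed.

Lemma tens_map_id t : tens_map idfun idfun t = t.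
Proof.
move: t; apply: (eq_tens (f := tens_map idfun idfun) (g := idfun)) => x y /=.
by rewrite tens_map_tensor.
Qed.

Lemma tens_map0l (f : {linear M -> M'}) (g : {linear N -> N'}) t :
  (forall x, f x = 0) -> tens_map f g t = 0.
Proof.
move=> f0; move: t; apply: (eq_tens (f := tens_map f g) (g := \0)) => x y /=.
by rewrite tens_map_tensor f0 tensor0l.
Qed.

Lemma tens_map0r (f : {linear M -> M'}) (g : {linear N -> N'}) t :
  (forall y, g y = 0) -> tens_map f g t = 0.
Proof.
move=> g0; move: t; apply: (eq_tens (f := tens_map f g) (g := \0)) => x y /=.
by rewrite tens_map_tensor g0 tensor0r.
Qed.

End TensorMapFacts.

(* Over a finite index type the direct sum is the product.                    *)
Section DirectSum.

Variables (I : finType) (A : I -> zmodType).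

Definition dsum : Type := {dffun forall i, A i}.

HB.instance Definition _ := Choice.on dsum.

Definition dsum_zero : dsum := finfun (fun i => 0).
Definition dsum_opp (t : dsum) : dsum := finfun (fun i => - t i).
Definition dsum_add (s t : dsum) : dsum := finfun (fun i => s i + t i).

Fact dsum_addA : associative dsum_add.
Proof. by move=> r s t; apply/ffunP => i; rewrite !ffunE addrA. Qed.
Fact dsum_addC : commutative dsum_add.
Proof. by move=> s t; apply/ffunP => i; rewrite !ffunE addrC. Qed.
Fact dsum_add0 : left_id dsum_zero dsum_add.
Proof. by move=> t; apply/ffunP => i; rewrite !ffunE add0r. Qed.
Fact dsum_addN : left_inverse dsum_zero dsum_opp dsum_add.
Proof. by move=> t; apply/ffunP => i; rewrite !ffunE addNr. Qed.

HB.instance Definition _ :=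
  GRing.isZmodule.Build dsum dsum_addA dsum_addC dsum_add0 dsum_addN.

Lemma dsumP (s t : dsum) : (forall i, s i = t i) <-> s = t.
Proof. exact: ffunP. Qed.

Definition dproj (i : I) (t : dsum) : A i := t i.

Fact dproj_is_zmod_morphism i : zmod_morphism (dproj i).
Proof. by move=> s t; rewrite /dproj !ffunE. Qed.

HB.instance Definition _ i :=
  GRing.isZmodMorphism.Build dsum (A i) (dproj i) (dproj_is_zmod_morphism i).

Lemma dsumBE (s t : dsum) i : (s - t : dsum) i = s i - t i.
Proof. exact: (raddfB (dproj i)). Qed.

Lemma dsumDE (s t : dsum) i : (s + t : dsum) i = s i + t i.
Proof. exact: (raddfD (dproj i)). Qed.

Lemma dsum0E i : (0 : dsum) i = 0.
Proof. exact: (raddf0 (dproj i)). Qed.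

Definition dinj (i : I) (x : A i) : dsum :=
  finfun (fun j => dfwith (fun j => 0 : A j) x j).

Lemma dinj_id i (x : A i) : dinj x i = x.
Proof. by rewrite ffunE dfwith_in. Qed.

Lemma dinj_neq i j (x : A i) : i != j -> dinj x j = 0.
Proof. by move=> ij; rewrite ffunE dfwith_out. Qed.

Fact dinj_is_zmod_morphism i : zmod_morphism (@dinj i).
Proof.
move=> x y; apply/dsumP => j; rewrite dsumBE.
have [<-|ij] := eqVneq i j; first by rewrite !dinj_id.
by rewrite !dinj_neq // subr0.
Qed.

HB.instance Definition _ i :=
  GRing.isZmodMorphism.Build (A i) dsum (@dinj i) (@dinj_is_zmod_morphism i).

Lemma dsum_sumE (t : dsum) : t = \sum_i dinj (t i).
Proof.
apply/dsumP => j; rewrite -[RHS]/(dproj j _) raddf_sum /= (bigD1 j) //=.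
rewrite big1 ?addr0 => [|i ij]; first by rewrite /dproj dinj_id.
by rewrite /dproj dinj_neq.
Qed.

End DirectSum.

Section LDirectSum.

Variables (R : pzRingType) (I : finType) (M : I -> lmodType R).

Definition ldsum : Type := dsum (fun i => M i : zmodType).

HB.instance Definition _ := GRing.Zmodule.on ldsum.

Definition ldsum_scale (a : R) (t : ldsum) : ldsum :=
  finfun (fun i => a *: t i).

Fact ldsum_scaleA a b t :
  ldsum_scale a (ldsum_scale b t) = ldsum_scale (a * b) t.
Proof. by apply/dsumP => i; rewrite !ffunE scalerA. Qed.
Fact ldsum_scale1 : left_id 1 ldsum_scale.
Proof. by move=> t; apply/dsumP => i; rewrite !ffunE scale1r. Qed.
Fact ldsum_scaleDr : right_distributive ldsum_scale +%R.
Proof. by move=> a s t; apply/dsumP => i; rewrite !ffunE scalerDr. Qed.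
Fact ldsum_scaleDl t : {morph ldsum_scale^~ t : a b / a + b}.
Proof. by move=> a b; apply/dsumP => i; rewrite !ffunE scalerDl. Qed.

HB.instance Definition _ :=
  GRing.Zmodule_isLmodule.Build R ldsum
    ldsum_scaleA ldsum_scale1 ldsum_scaleDr ldsum_scaleDl.

Definition ldproj (i : I) (t : ldsum) : M i := t i.

Fact ldproj_is_linear i : linear (ldproj i).
Proof. by move=> a s t; rewrite /ldproj !ffunE. Qed.

HB.instance Definition _ i :=
  GRing.isLinear.Build R ldsum (M i) _ (ldproj i) (ldproj_is_linear i).

Lemma ldsum_linE a (s t : ldsum) i : (a *: s + t : ldsum) i = a *: s i + t i.
Proof. exact: (linearP (ldproj i)). Qed.

Definition ldinj (i : I) (x : M i) : ldsum :=
  dinj (A := fun i => M i : zmodType) x.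

Lemma ldinj_id i (x : M i) : ldinj x i = x.
Proof. exact: dinj_id. Qed.

Lemma ldinj_neq i j (x : M i) : i != j -> ldinj x j = 0.
Proof. exact: dinj_neq. Qed.

Fact ldinj_is_linear i : linear (@ldinj i).
Proof.
move=> a x y; apply/dsumP => j; rewrite ldsum_linE.
have [<-|ij] := eqVneq i j; first by rewrite !ldinj_id.
by rewrite !ldinj_neq // scaler0 addr0.
Qed.

HB.instance Definition _ i :=
  GRing.isLinear.Build R (M i) ldsum _ (@ldinj i) (@ldinj_is_linear i).

Lemma ldsum_sumE (t : ldsum) : t = \sum_i ldinj (t i).
Proof. exact: dsum_sumE. Qed.

End LDirectSum.

Section LMatrix.

Variables (R : pzRingType) (I J : finType).
Variables (M : I -> lmodType R) (N : J -> lmodType R).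
Variable a : forall j i, {linear M i -> N j}.

Definition lmatrix (t : ldsum M) : ldsum N :=
  finfun (fun j => \sum_i a j i (t i) : (N j : zmodType)).

Lemma lmatrixE t j : lmatrix t j = \sum_i a j i (t i).
Proof. exact: ffunE. Qed.

Fact lmatrix_is_linear : linear lmatrix.
Proof.
move=> c s t; apply/dsumP => j; rewrite ldsum_linE.
rewrite !lmatrixE scaler_sumr -big_split /=; apply: eq_bigr => i _.
by rewrite ldsum_linE linearP.
Qed.

HB.instance Definition _ :=
  GRing.isLinear.Build R (ldsum M) (ldsum N) _ lmatrix lmatrix_is_linear.

Lemma lmatrix_inj i (x : M i) j : lmatrix (ldinj x) j = a j i x.
Proof.
rewrite lmatrixE (bigD1 i) //= ldinj_id big1 ?addr0 // => i' i'i.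
by rewrite ldinj_neq ?linear0 // eq_sym.
Qed.

End LMatrix.

(* Connective complexes are indexed by nat: the modules in negative degrees   *)
(* vanish, and cx_d X n is the differential from degree n.+1 to degree n.     *)

Record complex (R : pzRingType) := Complex {
  cx_obj :> nat -> lmodType R;
  cx_d : forall n, {linear cx_obj n.+1 -> cx_obj n};
  cx_dd : forall n x, cx_d n (cx_d n.+1 x) = 0
}.

Record cxmorph (R : pzRingType) (X X' : complex R) := CxMorph {
  cxm :> forall n, {linear X n -> X' n};
  cxm_d : forall n x, cxm n (cx_d X n x) = cx_d X' n (cxm n.+1 x)
}.

Definition cxid (R : pzRingType) (X : complex R) : cxmorph X X :=
  @CxMorph R X X (fun n => idfun) (fun n x => erefl).

Record zcomplex := ZComplex {
  zcx_obj :> nat -> zmodType;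
  zcx_d : forall n, {additive zcx_obj n.+1 -> zcx_obj n};
  zcx_dd : forall n x, zcx_d n (zcx_d n.+1 x) = 0
}.

Record zmorph (C D : zcomplex) := ZMorph {
  zm :> forall n, {additive C n -> D n};
  zm_d : forall n x, zm n (zcx_d C n x) = zcx_d D n (zm n.+1 x)
}.

Section Homology.

Variables (C : zcomplex) (n : nat).

Definition is_cycle : {pred C n} :=
  match n return C n -> bool with
  | 0 => fun=> true
  | m.+1 => fun x => zcx_d C m x == 0
  end.

Fact is_cycle_zmod_closed : zmod_closed is_cycle.
Proof.
rewrite /is_cycle; case: n => [|m]; first by split.
split=> [|x y]; first by rewrite -topredE /= raddf0.
by rewrite -!topredE /= raddfB => /eqP-> /eqP->; rewrite subrr.
Qed.

HB.instance Definition _ :=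
  GRing.isZmodClosed.Build (C n) is_cycle is_cycle_zmod_closed.

Record cycles := Cycle { cycle_val : C n; cycle_valP : cycle_val \in is_cycle }.

HB.instance Definition _ := [isSub for cycle_val].
HB.instance Definition _ := [Choice of cycles by <:].
HB.instance Definition _ := [SubChoice_isSubZmodule of cycles by <:].

Definition is_boundary : {pred cycles} :=
  fun z => `[< exists y, cycle_val z = zcx_d C n y >].

Fact is_boundary_zmod_closed : zmod_closed is_boundary.
Proof.
split=> [|z z' /asboolP[y zy] /asboolP[y' zy']]; apply/asboolP.
  by exists 0; rewrite raddf0; exact: (raddf0 (\val : cycles -> C n)).
by exists (y - y'); rewrite raddfB /= -zy -zy';
  exact: (raddfB (\val : cycles -> C n)).
Qed.

HB.instance Definition _ :=
  GRing.isZmodClosed.Build cycles is_boundary is_boundary_zmod_closed.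

Definition homology : zmodType := Quotient.quot is_boundary.

Definition homology_class (z : cycles) : homology :=
  \pi_(Quotient.quot is_boundary) z.

Lemma homology_classP z z' :
  homology_class z = homology_class z' <->
  exists y, cycle_val z - cycle_val z' = zcx_d C n y.
Proof.
rewrite /homology_class; split=> [/eqP|[y zz'y]].
  by rewrite -Quotient.idealrBE => /asboolP[y zz'y]; exists y.
by apply/eqP; rewrite -Quotient.idealrBE; apply/asboolP; exists y.
Qed.

End Homology.

Fact zmorph_cycle (C D : zcomplex) (f : zmorph C D) n (z : cycles C n) :
  f n (cycle_val z) \in @is_cycle D n.
Proof.
case: z; case: n => [|n] //= x; rewrite -!topredE /= -zm_d => /eqP->.
by rewrite raddf0.
Qed.

Definition cycles_map (C D : zcomplex) (f : zmorph C D) n (z : cycles C n) :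
  cycles D n := Cycle (zmorph_cycle f z).

Definition homology_map (C D : zcomplex) (f : zmorph C D) n
  (h : homology C n) : homology D n := homology_class (cycles_map f (repr h)).

Lemma homology_map_class (C D : zcomplex) (f : zmorph C D) n (z : cycles C n) :
  homology_map f (homology_class z) = homology_class (cycles_map f z).
Proof.
apply/homology_classP.
have /homology_classP[y zy] :
  homology_class (repr (homology_class z)) = homology_class z.
  by rewrite {1}/homology_class reprK.
by exists (f n.+1 y); rewrite -zm_d -zy raddfB.
Qed.

Definition quasi_iso (C D : zcomplex) (f : zmorph C D) : Prop :=
  forall n, bijective (homology_map f (n := n)).

Record bideg (n : nat) := Bideg {
  bdl : nat;
  bdr : nat;
  bideg_sum : (bdl + bdr == n)%N
}.

Section BidegFinite.

Variable n : nat.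

Definition ord_of_bideg (p : bideg n) : 'I_n.+1 := inord (bdl p).

Definition bideg_of_ord (i : 'I_n.+1) : bideg n :=
  @Bideg n i (n - i)%N (introT eqP (subnKC (leq_ord i))).

Fact ord_of_bidegK : cancel ord_of_bideg bideg_of_ord.
Proof.
case=> k l kl; rewrite /ord_of_bideg /bideg_of_ord /=.
have lkn : (k < n.+1)%N by rewrite ltnS -(eqP kl) leq_addr.
move: (introT _ _); rewrite (inordK lkn).
have -> : (n - k)%N = l by rewrite -(eqP kl) addKn.
by move=> kl'; rewrite (bool_irrelevance kl' kl).
Qed.

HB.instance Definition _ := Countable.copy (bideg n) (can_type ord_of_bidegK).
HB.instance Definition _ : isFinite (bideg n) := CanIsFinite ord_of_bidegK.

End BidegFinite.

Definition bidegSl n (p : bideg n) : bideg n.+1 :=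
  @Bideg n.+1 (bdl p).+1 (bdr p) (bideg_sum p).

Fact bidegSr_subproof n (p : bideg n) : (bdl p + (bdr p).+1 == n.+1)%N.
Proof. by rewrite addnS (eqP (bideg_sum p)). Qed.

Definition bidegSr n (p : bideg n) : bideg n.+1 := Bideg (bidegSr_subproof p).

Section TensorComplex.

Variables (R : pzRingType) (X : complex R^c) (Y : complex R).

Local Notation tcx_obj n :=
  (dsum (fun p : bideg n => tens (X (bdl p)) (Y (bdr p)))).

(* The bidegree (k, l) component of the differential receives contributions   *)
(* from bidegrees (k+1, l) and (k, l+1), the latter with the sign (-1)^k.     *)
Definition tcx_d (n : nat) (t : tcx_obj n.+1) : tcx_obj n :=
  finfun (fun p : bideg n =>
    tens_map (cx_d X (bdl p)) idfun (t (bidegSl p))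
    + tens_map idfun (cx_d Y (bdr p)) (t (bidegSr p)) *~ (-1) ^+ bdl p).

Fact tcx_d_is_zmod_morphism n : zmod_morphism (@tcx_d n).
Proof.
move=> s t; apply/dsumP => p; rewrite dsumBE !ffunE !raddfB /=.
by rewrite mulrzBl opprD addrACA.
Qed.

HB.instance Definition _ n :=
  GRing.isZmodMorphism.Build (tcx_obj n.+1) (tcx_obj n) (@tcx_d n)
    (@tcx_d_is_zmod_morphism n).

Fact tcx_dd n t : tcx_d (@tcx_d n.+1 t) = 0.
Proof.
apply/dsumP => p; rewrite dsum0E !ffunE !raddfD /= !raddfMz /= !tens_map_comp.
rewrite [tens_map _ _ (t (bidegSl (bidegSl p)))]tens_map0l; last first.
  by move=> x; exact: cx_dd.
rewrite [tens_map _ _ (t (bidegSr (bidegSr p)))]tens_map0r; last first.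
  by move=> y; exact: cx_dd.
rewrite add0r mul0rz addr0 exprS mulN1r mulrNz addrC.
apply/eqP; rewrite subr_eq0; apply/eqP; congr (_ *~ _).
rewrite /bidegSr /bidegSl /=; move: (bidegSr_subproof (@Bideg n.+1 _ _ _)) => e.
rewrite (bool_irrelevance e (bidegSr_subproof p)).
exact: eq_tens_map.
Qed.

Definition tensor_complex : zcomplex :=
  @ZComplex (fun n => tcx_obj n) (fun n => @tcx_d n) tcx_dd.

End TensorComplex.

Section TensorComplexMap.

Variables (R : pzRingType) (X X' : complex R^c) (Y Y' : complex R).
Variables (eta : cxmorph X X') (theta : cxmorph Y Y').

Definition tcx_map (n : nat) (t : tensor_complex X Y n) :
    tensor_complex X' Y' n :=
  finfun (fun p : bideg n => tens_map (eta (bdl p)) (theta (bdr p)) (t p)).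

Fact tcx_map_is_zmod_morphism n : zmod_morphism (@tcx_map n).
Proof. by move=> s t; apply/dsumP => p; rewrite dsumBE !ffunE !raddfB. Qed.

HB.instance Definition _ n :=
  GRing.isZmodMorphism.Build (tensor_complex X Y n) (tensor_complex X' Y' n)
    (@tcx_map n) (@tcx_map_is_zmod_morphism n).

Fact tcx_map_d n t :
  @tcx_map n (zcx_d (tensor_complex X Y) n t) =
  zcx_d (tensor_complex X' Y') n (tcx_map t).
Proof.
apply/dsumP => p; rewrite !ffunE raddfD raddfMz /= !tens_map_comp.
by congr (_ + _ *~ _); apply: eq_tens_map => x //=; rewrite cxm_d.
Qed.

Definition tensor_complex_map :
    zmorph (tensor_complex X Y) (tensor_complex X' Y') :=
  @ZMorph _ _ (fun n => @tcx_map n) tcx_map_d.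

End TensorComplexMap.

Definition monotone n m (f : {ffun 'I_n.+1 -> 'I_m.+1}) :=
  [forall i : 'I_n.+1, forall j : 'I_n.+1, (i <= j)%N ==> (f i <= f j)%N].

Record Dmap (n m : nat) := DMap {
  dmap :> {ffun 'I_n.+1 -> 'I_m.+1};
  dmap_mono : monotone dmap
}.

HB.instance Definition _ n m := [isSub for @dmap n m].
HB.instance Definition _ n m := [Finite of Dmap n m by <:].

Lemma dmap_le n m (f : Dmap n m) (i j : 'I_n.+1) : (i <= j)%N -> (f i <= f j)%N.
Proof. by case: f => f /= /forallP/(_ i)/forallP/(_ j)/implyP. Qed.

Lemma monotoneP n m (f : 'I_n.+1 -> 'I_m.+1) :
  (forall i j : 'I_n.+1, (i <= j)%N -> (f i <= f j)%N) -> monotone (finfun f).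
Proof.
move=> fm; apply/forallP => i; apply/forallP => j; apply/implyP => ij.
by rewrite !ffunE fm.
Qed.

Lemma dmapP n m (f g : Dmap n m) : f =1 g -> f = g.
Proof. by move=> fg; apply: val_inj; apply/ffunP. Qed.

Fact did_subproof n : monotone (finfun (@id 'I_n.+1)).
Proof. by apply: monotoneP. Qed.

Definition did n : Dmap n n := DMap (did_subproof n).

Lemma didE n i : did n i = i. Proof. by rewrite ffunE. Qed.

Fact dcomp_subproof n m p (f : Dmap m p) (g : Dmap n m) :
  monotone (finfun (fun i => f (g i))).
Proof. by apply: monotoneP => i j ij; do 2!apply: dmap_le. Qed.

Definition dcomp n m p (f : Dmap m p) (g : Dmap n m) : Dmap n p :=
  DMap (dcomp_subproof f g).

Lemma dcompE n m p (f : Dmap m p) (g : Dmap n m) i : dcomp f g i = f (g i).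
Proof. by rewrite ffunE. Qed.

Lemma dcompA n m p q (f : Dmap p q) (g : Dmap m p) (h : Dmap n m) :
  dcomp f (dcomp g h) = dcomp (dcomp f g) h.
Proof. by apply: dmapP => i; rewrite !dcompE. Qed.

Fact delta_subproof n (i : 'I_n.+2) : monotone (finfun (fintype.lift i)).
Proof. by apply: monotoneP => j k jk; rewrite /= leq_bump2. Qed.

Definition delta n (i : 'I_n.+2) : Dmap n n.+1 := DMap (delta_subproof i).

Lemma deltaE n (i : 'I_n.+2) j : delta i j = fintype.lift i j.
Proof. by rewrite ffunE. Qed.

Lemma delta_delta n (i : 'I_n.+2) (j : 'I_n.+3) : (i < j)%N ->
  dcomp (delta j) (delta i) =
  dcomp (delta (inord i : 'I_n.+3)) (delta (inord j.-1 : 'I_n.+2)).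
Proof.
move=> ij; apply: dmapP => k; rewrite !dcompE !deltaE; apply: val_inj => /=.
have lij : (i < n.+3)%N by rewrite (ltn_trans (ltn_ord i)).
have lj : (j.-1 < n.+2)%N by case: j ij => -[|j] //= + _; rewrite ltnS.
rewrite !inordK // /bump; case: j ij {lj} => -[|j] //= _ ij.
by do ![case: leqP => ?]; lia.
Qed.

Definition surj n m (f : Dmap n m) := [forall j, exists i, f i == j].

Lemma surjP n m (f : Dmap n m) : reflect (forall j, exists i, f i = j) (surj f).
Proof.
apply: (iffP forallP) => fs j; first by have /existsP[i /eqP] := fs j; exists i.
by have [i fij] := fs j; apply/existsP; exists i; rewrite fij.
Qed.

(* A surjection [n] -> [k] has k <= n, so k is taken in 'I_n.+1.              *)
Record Dsurj (n : nat) := DSurj {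
  dtgt : 'I_n.+1;
  dsurj :> Dmap n dtgt;
  dsurjP : surj dsurj
}.

Section DsurjFinite.

Variable n : nat.

Let code := {k : 'I_n.+1 & {f : Dmap n k | surj f}}.

Definition Dsurj_code (f : Dsurj n) : code :=
  existT _ (dtgt f) (exist _ (dsurj f) (dsurjP f)).

Definition Dsurj_decode (c : code) : Dsurj n := DSurj (valP (tagged c)).

Fact Dsurj_codeK : cancel Dsurj_code Dsurj_decode.
Proof. by move=> [k f fs]; congr DSurj; exact: bool_irrelevance. Qed.

HB.instance Definition _ := Countable.copy (Dsurj n) (can_type Dsurj_codeK).
HB.instance Definition _ : isFinite (Dsurj n) := CanIsFinite Dsurj_codeK.

End DsurjFinite.

Lemma dfactor_inj n k l (f : Dmap n k) (f' : Dmap n l) p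
    (iota : Dmap k p) (iota' : Dmap l p) :
    surj f -> surj f' -> injective iota -> injective iota' ->
    dcomp iota f = dcomp iota' f' ->
  k = l /\ (forall i, f i = f' i :> nat).
Proof.
move=> fs fs' ii ii' e.
have wlog_le : forall n k l (f : Dmap n k) (f' : Dmap n l) p
    (iota : Dmap k p) (iota' : Dmap l p),
    surj f -> injective iota -> injective iota' ->
    dcomp iota f = dcomp iota' f' -> forall i, (f i <= f' i)%N.
  move=> {fs fs' ii ii' e f f' iota iota'} {}n {}k {}l f f' {}p iota iota'.
  move=> /surjP fs ii ii' e.
  have lt_f i j : (f i < f j)%N -> (f' i < f' j)%N.
    move=> fij; rewrite ltn_neqAle; apply/andP; split; last first.
      by apply: dmap_le; rewrite leqNgt; apply/negP => /ltnW/(dmap_le f); lia.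
    apply/eqP => /val_inj f'ij; have := congr1 (fun h : Dmap _ _ => h i) e.
    have := congr1 (fun h : Dmap _ _ => h j) e; rewrite /= !dcompE f'ij => <-.
    by move=> /ii fE; rewrite fE ltnn in fij.
  move=> i; have [m] : exists m, m = f i :> nat by exists (f i).
  elim: m i => [|m IHm] i fi; first by rewrite -fi.
  have mk : (m < k.+1)%N by rewrite (ltn_trans _ (ltn_ord (f i))) // -fi.
  have [j fj] := fs (Ordinal mk); have fjm : m = f j :> nat by rewrite fj.
  have := IHm _ fjm; have := lt_f j i; lia.
have ff' i : f i = f' i :> nat.
  apply/eqP; rewrite eqn_leq (wlog_le _ _ _ _ _ _ iota iota') //.
  by rewrite (wlog_le _ _ _ _ _ _ iota' iota).
split=> //; apply/eqP; rewrite eqn_leq -ltnS -[X in _ && X]ltnS.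
have /surjP/(_ ord_max)[i fi] := fs; have /surjP/(_ ord_max)[j fj] := fs'.
have := ff' i; have := ff' j; rewrite fi fj /=.
by have := ltn_ord (f' i); have := ltn_ord (f j); lia.
Qed.

Lemma Dsurj_eq n (f f' : Dsurj n) :
  dtgt f = dtgt f' :> nat -> (forall i, f i = f' i :> nat) -> f = f'.
Proof.
case: f f' => [k f fs] [k' f' fs'] /= /val_inj kk'; subst k' => ff'.
have e : f = f' by apply: dmapP => i; apply: val_inj; exact: ff'.
by subst f'; rewrite (bool_irrelevance fs fs').
Qed.

Lemma dfactor_uniq n (f f' : Dsurj n) p
    (iota : Dmap (dtgt f) p) (iota' : Dmap (dtgt f') p) :
  injective iota -> injective iota' ->
  dcomp iota f = dcomp iota' f' -> f = f'.
Proof.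
move=> ii ii' e.
have [] := dfactor_inj (dsurjP f) (dsurjP f') ii ii' e; exact: Dsurj_eq.
Qed.

Lemma dcomp_surjI n k p (f : Dmap n k) (iota iota' : Dmap k p) :
  surj f -> dcomp iota f = dcomp iota' f -> iota = iota'.
Proof.
move=> /surjP fs e; apply: dmapP => j; have [i <-] := fs j.
by rewrite -!dcompE e.
Qed.

Lemma dfactor_exists n p (h : Dmap n p) :
  exists (f : Dsurj n) (iota : Dmap (dtgt f) p),
    injective iota /\ dcomp iota f = h.
Proof.
pose S := [set h i | i : 'I_n.+1]; pose k := #|S|.-1.
have Sk : #|S| = k.+1.
  by rewrite prednK //; apply/card_gt0P; exists (h ord0); exact: imset_f.
have kn : (k < n.+1)%N.
  by rewrite -Sk (leq_trans (leq_imset_card _ _)) // card_ord.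
pose r (v : 'I_p.+1) := #|[set w in S | (w < v)%N]|.
have r_lt (v w : 'I_p.+1) : v \in S -> (v < w)%N -> (r v < r w)%N.
  move=> vS vw; apply: proper_card; apply/properP; split.
    by apply/subsetP => u; rewrite !inE => /andP[-> /=]; lia.
  by exists v; rewrite !inE vS ?vw // ltnn.
have r_ltk v : v \in S -> (r v < k.+1)%N.
  move=> vS; rewrite -Sk; apply: proper_card; apply/properP; split.
    by apply/subsetP => u; rewrite !inE => /andP[].
  by exists v; rewrite // !inE ltnn andbF.
have r_inj : {in S &, injective r}.
  move=> v w vS wS rvw; apply: val_inj => /=.
  by have := r_lt v w vS; have := r_lt w v wS; lia.
pose f0 v : 'I_k.+1 := inord (r v).
have f0E v : v \in S -> f0 v = r v :> nat by move=> vS; rewrite inordK ?r_ltk.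
have f0_inj : {in S &, injective f0}.
  by move=> v w vS wS /(congr1 val) /=; rewrite !f0E //; exact: r_inj.
have f0_surj j : exists i, f0 (h i) = j.
  have : j \in f0 @: S.
    have /eqP -> // : f0 @: S == setT.
    by rewrite eqEcard subsetT cardsT card_ord card_in_imset //= Sk.
  by case/imsetP => _ /imsetP[i _ ->] ->; exists i.
have hS i : h i \in S by exact: imset_f.
have f_mono : monotone (finfun (fun i => f0 (h i))).
  apply: monotoneP => i j ij; rewrite !f0E //.
  have [hij|hij] := ltnP (h i) (h j); first by rewrite ltnW // r_lt.
  have -> // : h i = h j; apply: val_inj => /=.
  by have := dmap_le h ij; lia.
pose f := DMap f_mono.
have fE i : f i = f0 (h i) by rewrite ffunE.
have fs : surj f.
  by apply/surjP => j; have [i fi] := f0_surj j; exists i; rewrite fE.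
have pre j : exists i, f i == j.
  by have /surjP/(_ j)[i <-] := fs; exists i.
pose s j := xchoose (pre j).
have fsK j : f (s j) = j by apply/eqP; exact: (xchooseP (pre j)).
have iota_mono : monotone (finfun (fun j => h (s j))).
  apply: monotoneP => j j' jj'; rewrite leqNgt; apply/negP => hlt.
  by have := r_lt _ _ (hS _) hlt; rewrite -!f0E // -!fE !fsK; lia.
exists (@DSurj n (Ordinal kn) f fs), (DMap iota_mono); split=> /= [j j'|].
  by rewrite !ffunE => e; rewrite -[j]fsK -[j']fsK !fE e.
apply: dmapP => i; rewrite dcompE /= ffunE; apply: f0_inj => //.
by rewrite -!fE fsK.
Qed.

Section DoldKan.

Variables (S : pzRingType) (X : complex S).

(* Only used for injective iota, which is then the identity when k = l. The   *)
(* differential X_l -> X_{l-1} is cx_d X l.-1, whence the sign (-1)^l.        *)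
Definition DKface (k l : nat) (iota : Dmap k l) : X l -> X k :=
  match k =P l with
  | ReflectT e => ecast l (X l -> X k) e id
  | ReflectF _ =>
    match l return Dmap k l -> X l -> X k with
    | 0 => fun _ _ => 0
    | l'.+1 =>
      match l' =P k with
      | ReflectT e => ecast k (Dmap k l'.+1 -> X l'.+1 -> X k) e
          (fun iota x =>
             if iota == delta ord_max then (-1) ^+ l'.+1 *: cx_d X l' x else 0)
      | ReflectF _ => fun _ _ => 0
      end
    end iota
  end.

Fact DKface_is_linear k l (iota : Dmap k l) : linear (DKface iota).
Proof.
rewrite /DKface; case: eqP => [e|_]; first by case: _ / e.
case: l iota => [|l] iota a x y; first by rewrite scaler0 addr0.
case: eqP => [e|_]; last by rewrite scaler0 addr0.
case: _ / e iota => iota; case: ifP => _; last by rewrite scaler0 addr0.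
by rewrite linearP scalerDr !scalerA commr_sign.
Qed.

HB.instance Definition _ k l (iota : Dmap k l) :=
  GRing.isLinear.Build S (X l) (X k) _ (DKface iota) (DKface_is_linear iota).

Lemma DKface_endo k (iota : Dmap k k) x : DKface iota x = x.
Proof. by rewrite /DKface; case: eqP => // e; rewrite eq_axiomK. Qed.

Lemma DKface_delta k (iota : Dmap k k.+1) x :
  DKface iota x =
  if iota == delta ord_max then (-1) ^+ k.+1 *: cx_d X k x else 0.
Proof.
rewrite /DKface; case: eqP => [|_]; first lia.
by case: eqP => // e; rewrite eq_axiomK.
Qed.

Lemma DKface_gap k l (iota : Dmap k l) x : (k.+1 < l)%N -> DKface iota x = 0.
Proof.
move=> kl; rewrite /DKface; case: eqP => [|_]; first lia.
by case: l iota x kl => // l iota x kl; case: eqP => //; lia.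
Qed.

Lemma dmap_inj_le k l (iota : Dmap k l) : injective iota -> (k <= l)%N.
Proof. by move=> /leq_card; rewrite !card_ord ltnS. Qed.

Lemma dmap_inj_endo k (iota : Dmap k k) : injective iota -> iota = did k.
Proof.
move=> ii.
have fs : surj iota.
  by apply/surjP => j; have [g _ gK] := injF_bij ii; exists (g j); rewrite gK.
have ids : surj (did k) by apply/surjP => j; exists j; rewrite didE.
have id_inj : injective (did k) by move=> i j; rewrite !didE.
have e : dcomp (did k) iota = dcomp iota (did k).
  by apply: dmapP => i; rewrite !dcompE !didE.
have [_ h] := dfactor_inj fs ids id_inj ii e.
by apply: dmapP => i; apply: val_inj; exact: h.
Qed.

Lemma DKface_comp k l m (iota : Dmap k l) (iota' : Dmap l m) x :
    injective iota -> injective iota' ->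
  DKface iota (DKface iota' x) = DKface (dcomp iota' iota) x.
Proof.
move=> ii ii'.
have := dmap_inj_le ii'; rewrite leq_eqVlt => /predU1P[e|lm].
  subst m; rewrite DKface_endo (dmap_inj_endo ii').
  by congr (DKface _ x); apply: dmapP => i; rewrite dcompE didE.
have := dmap_inj_le ii; rewrite leq_eqVlt => /predU1P[e|kl].
  subst l; rewrite DKface_endo (dmap_inj_endo ii).
  by congr (DKface _ x); apply: dmapP => i; rewrite dcompE didE.
rewrite [RHS]DKface_gap; last by rewrite (leq_trans _ lm).
have [lm'|lm'] := ltnP l.+1 m.
  by rewrite (DKface_gap iota' x lm') linear0.
have {lm lm'} e : m = l.+1 by lia.
subst m; rewrite DKface_delta; case: ifP => _; last exact: linear0.
rewrite linearZ /=.
have [kl'|kl'] := ltnP k.+1 l; first by rewrite DKface_gap // scaler0.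
have {kl kl'} e : l = k.+1 by lia.
subst l; rewrite DKface_delta; case: ifP => _; last by rewrite scaler0.
by rewrite cx_dd !scaler0.
Qed.

Definition DKentry n m (eta : Dmap n m) (f : Dsurj n) (g : Dsurj m) :
    X (dtgt g) -> X (dtgt f) :=
  if [pick iota : Dmap (dtgt f) (dtgt g) |
        injectiveb iota && (dcomp g eta == dcomp iota f)]
  is Some iota then DKface iota else fun=> 0.
Arguments DKentry {n m} eta f g.

Fact DKentry_is_linear n m (eta : Dmap n m) f g : linear (DKentry eta f g).
Proof.
rewrite /DKentry; case: pickP => [iota _|_] a x y; first exact: linearP.
by rewrite scaler0 addr0.
Qed.

HB.instance Definition _ n m (eta : Dmap n m) f g :=
  GRing.isLinear.Build S (X (dtgt g)) (X (dtgt f)) _ (DKentry eta f g)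
    (@DKentry_is_linear n m eta f g).

Definition DK (n : nat) : lmodType S := ldsum (fun f : Dsurj n => X (dtgt f)).

Definition DKmap n m (eta : Dmap n m) : {linear DK m -> DK n} :=
  lmatrix (fun f g => DKentry eta f g).

Definition DKinj n (f : Dsurj n) : {linear X (dtgt f) -> DK n} :=
  @ldinj S (Dsurj n) (fun f => X (dtgt f)) f.
Arguments DKinj {n} f.

Definition DKproj n (f : Dsurj n) : {linear DK n -> X (dtgt f)} :=
  @ldproj S (Dsurj n) (fun f => X (dtgt f)) f.
Arguments DKproj {n} f.

Definition DKd n (i : 'I_n.+2) : {linear DK n.+1 -> DK n} := DKmap (delta i).

Lemma DKP n (s t : DK n) : (forall f, DKproj f s = DKproj f t) -> s = t.
Proof. by move=> st; apply/ffunP => f; exact: st. Qed.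

Lemma DKinj_id n (f : Dsurj n) x : DKproj f (DKinj f x) = x.
Proof. exact: ldinj_id. Qed.

Lemma DKinj_neq n (f f' : Dsurj n) x : f != f' -> DKproj f' (DKinj f x) = 0.
Proof. exact: ldinj_neq. Qed.

Lemma DK_sumE n (t : DK n) : t = \sum_f DKinj f (DKproj f t).
Proof. exact: ldsum_sumE. Qed.

Lemma eq_DK (V : lmodType S) n (a b : {linear DK n -> V}) :
  (forall f x, a (DKinj f x) = b (DKinj f x)) -> a =1 b.
Proof.
move=> ab t; rewrite (DK_sumE t) !linear_sum /=.
by apply: eq_bigr => f _; exact: ab.
Qed.

Lemma DKmap_inj n m (eta : Dmap n m) (f : Dsurj n) (g : Dsurj m)
    (iota : Dmap (dtgt f) (dtgt g)) x :
    injective iota -> dcomp g eta = dcomp iota f ->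
  DKmap eta (DKinj g x) = DKinj f (DKface iota x).
Proof.
move=> ii e; apply: DKP => f'.
rewrite [LHS]lmatrix_inj /= /DKentry.
have [<-|ff'] := eqVneq f f'; last rewrite DKinj_neq //; case: pickP => //=.
- move=> iota' /andP[_ /eqP e']; rewrite DKinj_id.
  have -> // : iota' = iota.
  by apply: (@dcomp_surjI _ _ _ f); rewrite ?dsurjP // -e.
- move=> /(_ iota); rewrite e eqxx andbT => /negP[]; exact/injectiveP.
- move=> iota' /andP[/injectiveP ii' /eqP e']; case/eqP: ff'.
  by apply: (dfactor_uniq ii ii'); rewrite -e.
Qed.

Lemma DKmap_comp n m p (theta : Dmap m p) (eta : Dmap n m) t :
  DKmap eta (DKmap theta t) = DKmap (dcomp theta eta) t.
Proof.
move: t; apply: (eq_DK (a := DKmap eta \o DKmap theta)) => h x /=.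
have [g [iota [ii e]]] := dfactor_exists (dcomp h theta).
have [f [iota' [ii' e']]] := dfactor_exists (dcomp g eta).
rewrite (DKmap_inj x ii (esym e)) (DKmap_inj _ ii' (esym e')) DKface_comp //.
rewrite (@DKmap_inj _ _ _ f h (dcomp iota iota')) //.
  by move=> i j; rewrite !dcompE => /ii/ii'.
by rewrite dcompA -e -!dcompA e'.
Qed.

Lemma DKd_DKd n (i : 'I_n.+2) (j : 'I_n.+3) t : (i < j)%N ->
  DKd i (DKd j t) = DKd (inord j.-1) (DKd (inord i) t).
Proof. by move=> ij; rewrite !DKmap_comp delta_delta. Qed.

End DoldKan.

Lemma alternating_sum0 (V : zmodType) n (a : 'I_n.+2 -> 'I_n.+3 -> V) :
    (forall (i : 'I_n.+2) (j : 'I_n.+3), (i < j)%N ->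
       a i j = a (inord j.-1) (inord i)) ->
  \sum_i \sum_j a i j *~ (-1) ^+ (i + j) = 0.
Proof.
move=> aE; rewrite pair_big /=.
pose F (p : 'I_n.+2 * 'I_n.+3) := a p.1 p.2 *~ (-1) ^+ (p.1 + p.2).
rewrite -/(\sum_p F p) (bigID (fun p : 'I_n.+2 * 'I_n.+3 => (p.1 < p.2)%N)) /=.
pose h (p : 'I_n.+2 * 'I_n.+3) : 'I_n.+2 * 'I_n.+3 := (inord p.2.-1, inord p.1).
pose h' (p : 'I_n.+2 * 'I_n.+3) : 'I_n.+2 * 'I_n.+3 := (inord p.2, inord p.1.+1).
rewrite [X in _ + X](reindex_onto h h') => [|[i j] /= ij]; last first.
  have jn : (j < n.+2)%N by have := ltn_ord i; lia.
  have i3 : (i.+1 < n.+3)%N by rewrite ltnS.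
  by congr pair; apply: val_inj; rewrite /= !inordK //= ?inordK //; lia.
rewrite [X in _ + X](eq_bigl (fun p : 'I_n.+2 * 'I_n.+3 => (p.1 < p.2)%N));
  last first.
  move=> [i j] /=; have i3 : (i < n.+3)%N by rewrite (ltn_trans (ltn_ord i)).
  have j2 : (j.-1 < n.+2)%N by have := ltn_ord j; lia.
  rewrite /h' /h xpair_eqE -!val_eqE /=.
  have j3 : (j.-1.+1 < n.+3)%N by rewrite ltnS.
  rewrite (inordK i3) (inordK j2) (inordK (ltn_ord i)) (inordK j3).
  by move: (nat_of_ord i) (nat_of_ord j) => k l; lia.
rewrite -big_split big1 //= => -[i j] /= ij; rewrite /F /h /= -aE //.
have i3 : (i < n.+3)%N by rewrite (ltn_trans (ltn_ord i)).
have j2 : (j.-1 < n.+2)%N by have := ltn_ord j; lia.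
rewrite !inordK //; have -> : (i + j = (j.-1 + i).+1)%N by lia.
by rewrite exprS mulN1r mulrNz addNr.
Qed.

Record shuffle_index (n : nat) := ShuffleIndex {
  shl : Dsurj n;
  shr : Dsurj n;
  shuffle_inj : injectiveb (fun i => (shl i, shr i))
}.

Section ShuffleIndexFinite.

Variable n : nat.

Let code := {p : Dsurj n * Dsurj n | injectiveb (fun i => (p.1 i, p.2 i))}.

Definition shuffle_index_code (p : shuffle_index n) : code :=
  exist _ (shl p, shr p) (shuffle_inj p).

Definition shuffle_index_decode (c : code) : shuffle_index n :=
  ShuffleIndex (valP c).

Fact shuffle_index_codeK : cancel shuffle_index_code shuffle_index_decode.
Proof. by move=> [f g fg]; congr ShuffleIndex; exact: bool_irrelevance. Qed.

HB.instance Definition _ :=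
  Countable.copy (shuffle_index n) (can_type shuffle_index_codeK).
HB.instance Definition _ : isFinite (shuffle_index n) :=
  CanIsFinite shuffle_index_codeK.

End ShuffleIndexFinite.

Lemma shuffle_index_eq n (p q : shuffle_index n) :
  shl p = shl q -> shr p = shr q -> p = q.
Proof.
case: p q => [f g fg] [f' g' fg'] /= ff' gg'; subst f' g'.
by congr ShuffleIndex; exact: bool_irrelevance.
Qed.

Section Shuffle.

Variables (R : pzRingType) (X : complex R^c) (Y : complex R).

Local Notation shuffle_obj n :=
  (dsum (fun p : shuffle_index n => tens (X (dtgt (shl p))) (Y (dtgt (shr p))))).

Local Notation DKtens n := (tens (DK X n) (DK Y n)).

(* shuffle_obj n is a direct summand of DKtens n through shuffle_incl and     *)
(* shuffle_proj. It is stable under DKtens_d (lemma shuffle_incl_d), so the   *)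
(* differential shuffle_d is the restriction of DKtens_d: see shuffle_d_inj.  *)
Definition shuffle_incl (n : nat) (t : shuffle_obj n) : DKtens n :=
  \sum_(p : shuffle_index n) tens_map (DKinj X (shl p)) (DKinj Y (shr p)) (t p).

Definition shuffle_proj (n : nat) (u : DKtens n) : shuffle_obj n :=
  finfun (fun p : shuffle_index n =>
    tens_map (DKproj X (shl p)) (DKproj Y (shr p)) u).

Definition DKtens_d (n : nat) (u : DKtens n.+1) : DKtens n :=
  \sum_(i < n.+2) tens_map (DKd X i) (DKd Y i) u *~ (-1) ^+ i.

Definition shuffle_d (n : nat) (t : shuffle_obj n.+1) : shuffle_obj n :=
  shuffle_proj (DKtens_d (shuffle_incl t)).

Fact shuffle_incl_is_zmod_morphism n : zmod_morphism (@shuffle_incl n).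
Proof.
move=> s t; rewrite /shuffle_incl -sumrB; apply: eq_bigr => p _.
by rewrite dsumBE raddfB.
Qed.

HB.instance Definition _ n :=
  GRing.isZmodMorphism.Build (shuffle_obj n) (DKtens n) (@shuffle_incl n)
    (@shuffle_incl_is_zmod_morphism n).

Fact shuffle_proj_is_zmod_morphism n : zmod_morphism (@shuffle_proj n).
Proof. by move=> s t; apply/dsumP => p; rewrite dsumBE !ffunE raddfB. Qed.

HB.instance Definition _ n :=
  GRing.isZmodMorphism.Build (DKtens n) (shuffle_obj n) (@shuffle_proj n)
    (@shuffle_proj_is_zmod_morphism n).

Fact DKtens_d_is_zmod_morphism n : zmod_morphism (@DKtens_d n).
Proof.
move=> s t; rewrite /DKtens_d -sumrB; apply: eq_bigr => i _.
by rewrite raddfB mulrzBl.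
Qed.

HB.instance Definition _ n :=
  GRing.isZmodMorphism.Build (DKtens n.+1) (DKtens n) (@DKtens_d n)
    (@DKtens_d_is_zmod_morphism n).

Fact shuffle_d_is_zmod_morphism n : zmod_morphism (@shuffle_d n).
Proof. by move=> s t; rewrite /shuffle_d !raddfB. Qed.

HB.instance Definition _ n :=
  GRing.isZmodMorphism.Build (shuffle_obj n.+1) (shuffle_obj n) (@shuffle_d n)
    (@shuffle_d_is_zmod_morphism n).

Definition shuffle_inj_at n (p : shuffle_index n) :
    {additive tens (X (dtgt (shl p))) (Y (dtgt (shr p))) -> shuffle_obj n} :=
  @dinj _ (fun p : shuffle_index n => tens (X (dtgt (shl p))) (Y (dtgt (shr p)))) p.

Lemma shuffle_incl_inj n (p : shuffle_index n) x y :
  shuffle_incl (shuffle_inj_at p (tensor x y)) =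
  tensor (DKinj X (shl p) x) (DKinj Y (shr p) y).
Proof.
rewrite /shuffle_incl (bigD1 p) //= dinj_id tens_map_tensor big1 ?addr0 //.
by move=> q qp; rewrite dinj_neq ?raddf0 // eq_sym.
Qed.

Lemma shuffle_projK n : cancel (@shuffle_incl n) (@shuffle_proj n).
Proof.
move=> t; apply/dsumP => p; rewrite ffunE raddf_sum (bigD1 p) //=.
rewrite tens_map_comp big1 ?addr0 => [|q qp]; rewrite ?tens_map_comp.
  rewrite -[RHS]tens_map_id; apply: eq_tens_map => x /=; exact: ldinj_id.
have [e|ne] := eqVneq (shl q) (shl p).
  apply: tens_map0r => y /=; apply: ldinj_neq; apply: contraNneq qp => e'.
  by apply/eqP; exact: shuffle_index_eq.
by apply: tens_map0l => x /=; exact: ldinj_neq.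
Qed.

Lemma eq_shuffle (V : zmodType) n (a b : {additive shuffle_obj n -> V}) :
    (forall p x y, a (shuffle_inj_at p (tensor x y)) =
                   b (shuffle_inj_at p (tensor x y))) ->
  a =1 b.
Proof.
move=> ab t; rewrite (dsum_sumE t) !raddf_sum /=; apply: eq_bigr => p _.
apply: (eq_tens (f := a \o shuffle_inj_at p) (g := b \o shuffle_inj_at p)).
exact: ab.
Qed.

Lemma shuffle_incl_d n t :
  shuffle_incl (@shuffle_d n t) = DKtens_d (shuffle_incl t).
Proof.
move: t; apply: (eq_shuffle (a := @shuffle_incl n \o @shuffle_d n)
                            (b := @DKtens_d n \o @shuffle_incl n.+1)) => p x y /=.
rewrite /shuffle_d shuffle_incl_inj /DKtens_d !raddf_sum /=.
apply: eq_bigr => i _; rewrite !raddfMz /=; congr (_ *~ _).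
rewrite tens_map_tensor.
have [f [iota [ii e]]] := dfactor_exists (dcomp (shl p) (delta i)).
have [g [iota' [ii' e']]] := dfactor_exists (dcomp (shr p) (delta i)).
rewrite /DKd (DKmap_inj x ii (esym e)) (DKmap_inj y ii' (esym e')).
have fg : injectiveb (fun j => (f j, g j)).
  apply/injectiveP => j j' [fj gj].
  have /injectiveP/(_ (delta i j) (delta i j')) := shuffle_inj p.
  rewrite -!dcompE -e -e' !dcompE fj gj => /(_ erefl).
  by rewrite !deltaE => /lift_inj.
rewrite -(@shuffle_incl_inj n (ShuffleIndex fg)) /=.
by congr (shuffle_incl _); exact: shuffle_projK.
Qed.

Lemma shuffle_d_inj n (p : shuffle_index n.+1) x y :
  shuffle_incl (shuffle_d (shuffle_inj_at p (tensor x y))) =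
  \sum_(i < n.+2)
    tensor (DKd X i (DKinj X (shl p) x)) (DKd Y i (DKinj Y (shr p) y))
      *~ (-1) ^+ i.
Proof.
rewrite shuffle_incl_d shuffle_incl_inj; apply: eq_bigr => i _.
by rewrite tens_map_tensor.
Qed.

Lemma DKtens_dd n u : DKtens_d (@DKtens_d n.+1 u) = 0.
Proof.
rewrite /DKtens_d -[RHS](alternating_sum0 (a := fun i j =>
  tens_map (DKd X i) (DKd Y i) (tens_map (DKd X j) (DKd Y j) u))) => [|i j ij].
  apply: eq_bigr => i _; rewrite raddf_sum /= mulrz_suml; apply: eq_bigr => j _.
  by rewrite raddfMz /= -mulrzA -exprD addnC.
by rewrite !tens_map_comp; apply: eq_tens_map => x /=; exact: DKd_DKd.
Qed.

Fact shuffle_dd n t : shuffle_d (@shuffle_d n.+1 t) = 0.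
Proof.
by rewrite -[LHS]shuffle_projK !shuffle_incl_d DKtens_dd raddf0.
Qed.

Definition shuffle_complex : zcomplex :=
  @ZComplex (fun n => shuffle_obj n) (fun n => @shuffle_d n) shuffle_dd.

End Shuffle.

Section DoldKanMap.

Variables (S : pzRingType) (X X' : complex S) (eta : cxmorph X X').

Lemma DKface_natural k l (iota : Dmap k l) x :
  eta k (DKface iota x) = DKface iota (eta l x).
Proof.
rewrite /DKface; case: eqP => [e|_]; first by case: _ / e iota x.
case: l iota x => [|l] iota x; first exact: linear0.
case: eqP => [e|_]; last exact: linear0.
case: _ / e iota => iota; case: ifP => _; last exact: linear0.
by rewrite linearZ /= cxm_d.
Qed.

Definition DKfun n (t : DK X n) : DK X' n :=
  finfun (fun f : Dsurj n => eta (dtgt f) (t f) : (X' (dtgt f) : zmodType)).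

Fact DKfun_is_linear n : linear (@DKfun n).
Proof.
by move=> a s t; apply/dsumP => f; rewrite ldsum_linE !ffunE linearP.
Qed.

HB.instance Definition _ n :=
  GRing.isLinear.Build S (DK X n) (DK X' n) _ (@DKfun n) (@DKfun_is_linear n).

Lemma DKfun_inj n (f : Dsurj n) x :
  DKfun (DKinj X f x) = DKinj X' f (eta (dtgt f) x).
Proof.
apply: DKP => g; rewrite /DKfun /= /ldproj ffunE.
have [<-|fg] := eqVneq f g; first by rewrite !ldinj_id.
by rewrite !ldinj_neq ?linear0.
Qed.

Lemma DKfun_natural n m (h : Dmap n m) t :
  DKfun (DKmap X h t) = DKmap X' h (DKfun t).
Proof.
move: t; apply: (eq_DK (a := @DKfun n \o DKmap X h)
                       (b := DKmap X' h \o @DKfun m)) => g x /=.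
have [f [iota [ii e]]] := dfactor_exists (dcomp g h).
rewrite (DKmap_inj x ii (esym e)) !DKfun_inj (DKmap_inj _ ii (esym e)).
by rewrite DKface_natural.
Qed.

End DoldKanMap.

Section ShuffleMap.

Variables (R : pzRingType) (X X' : complex R^c) (Y Y' : complex R).
Variables (eta : cxmorph X X') (theta : cxmorph Y Y').

Definition shuffle_map (n : nat) (t : shuffle_complex X Y n) :
    shuffle_complex X' Y' n :=
  finfun (fun p : shuffle_index n =>
    tens_map (eta (dtgt (shl p))) (theta (dtgt (shr p))) (t p)).

Fact shuffle_map_is_zmod_morphism n : zmod_morphism (@shuffle_map n).
Proof. by move=> s t; apply/dsumP => p; rewrite dsumBE !ffunE !raddfB. Qed.

HB.instance Definition _ n :=
  GRing.isZmodMorphism.Build (shuffle_complex X Y n) (shuffle_complex X' Y' n)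
    (@shuffle_map n) (@shuffle_map_is_zmod_morphism n).

Lemma shuffle_map_inj n (p : shuffle_index n) x y :
  shuffle_map (shuffle_inj_at X Y p (tensor x y)) =
  shuffle_inj_at X' Y' p
    (tensor (eta (dtgt (shl p)) x) (theta (dtgt (shr p)) y)).
Proof.
apply/dsumP => q; rewrite /shuffle_map ffunE.
have [<-|pq] := eqVneq p q; first by rewrite !dinj_id tens_map_tensor.
by rewrite !dinj_neq ?raddf0.
Qed.

Lemma shuffle_incl_map n (t : shuffle_complex X Y n) :
  shuffle_incl (shuffle_map t) =
  tens_map (@DKfun _ _ _ eta n) (@DKfun _ _ _ theta n) (shuffle_incl t).
Proof.
move: t; apply: (eq_shuffle
  (a := @shuffle_incl _ X' Y' n \o @shuffle_map n)
  (b := tens_map (@DKfun _ _ _ eta n) (@DKfun _ _ _ theta n)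
          \o @shuffle_incl _ X Y n)) => p x y.
rewrite /= -/(shuffle_inj_at X Y p) shuffle_map_inj !shuffle_incl_inj.
by rewrite tens_map_tensor /= !DKfun_inj.
Qed.

Fact shuffle_map_d n t :
  @shuffle_map n (zcx_d (shuffle_complex X Y) n t) =
  zcx_d (shuffle_complex X' Y') n (shuffle_map t).
Proof.
apply: (can_inj (@shuffle_projK _ X' Y' n)).
rewrite shuffle_incl_map /= !shuffle_incl_d shuffle_incl_map.
rewrite /DKtens_d raddf_sum /=; apply: eq_bigr => i _.
rewrite raddfMz /= !tens_map_comp; congr (_ *~ _).
by apply: eq_tens_map => x /=; exact: DKfun_natural.
Qed.

Definition shuffle_complex_map :
    zmorph (shuffle_complex X Y) (shuffle_complex X' Y') :=
  @ZMorph _ _ (fun n => @shuffle_map n) shuffle_map_d.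

End ShuffleMap.

(* Main.v *)
(* A jointly injective pair of surjections [n] -> [k], [n] -> [l] is a        *)
(* lattice path from (0,0) to (k,l) with n steps H = (1,0), V = (0,1),        *)
(* D = (1,1), so the shuffle product is a sum of X_k (x) Y_l over words in    *)
(* H, V, D. Its face i, for 0 < i < n, merges an adjacent HV or VH into D and *)
(* is zero on other words, face 0 is zero, and face n deletes the last step   *)
(* and applies the corresponding differentials. The map nabla sends x (x) y   *)
(* to the sum of the D-free words from (0,0) to (k,l), signed by the parity   *)
(* of the number of pairs V before H, so that the merges cancel in pairs.     *)
(*   Match each word s D v with s V H v, where s = H^a V^b; only the words    *)
(* H^a V^b are left out. If u has no components at such words s D v, then the *)
(* component of d u at s D v is +-(u(s V H v) + u(s H V v)), which makes a    *)
(* triangular system for the number of inversions. Hence every chain can be   *)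
(* corrected by a boundary to have no component at any s D v, and a chain c   *)
(* such that neither c nor d c has such components is determined by its       *)
(* components at the words H^a V^b, so that it is in the image of nabla.      *)
(* Together with the injectivity of nabla this gives the quasi-isomorphism.   *)

Require Import Defs.
From HB Require Import structures.
From mathcomp Require Import all_boot all_algebra.
From mathcomp Require Import boolp zify.

Set Implicit Arguments.
Unset Strict Implicit.
Unset Printing Implicit Defensive.

Import GRing.Theory.

Local Open Scope ring_scope.

(** [nabla] is a chain map because its interior faces cancel in pairs and the last face reproduces
    the differential of the tensor product ([nabla_d]); it is injective because the words H^a V^b
    already recover every component ([nabla_inj]). The other words are dealt with by the matching of
    s D v with s V H v. [kill_diag] removes all components at words s D v by subtracting a boundary,
    and [nabla_imageS] places in the image of [nabla] every chain c such that neither c nor d c has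
    such components. A cycle, or a chain whose boundary lies in the image, can be brought to this
    form; with injectivity this gives the two conditions of [quasi_isoP]. *)

Local Notation word := (seq (option bool)).
Local Notation H := (Some true).
Local Notation V := (Some false).
Local Notation D := None.

(* The steps that advance the first, respectively the second coordinate.      *)
Definition stepl : pred (option bool) := predC1 V.
Definition stepr : pred (option bool) := predC1 H.

Local Notation path_to n w k l :=
  [&& size w == n, count stepl w == k & count stepr w == l].

(** * Words: descents and inversions *)

Definition hv_word (a b : nat) : word := nseq a H ++ nseq b V.

(** Read up to the first D or the first factor V H, whichever comes first: what precedes it has no V
    before an H. The cases are the unmatched words, the words s D v and their partners s V H v. *)
Lemma word_trichotomy (w : word) :
  [\/ exists a b, w = hv_word a b,
      exists a b v, w = hv_word a b ++ D :: v
    | exists a b v, w = hv_word a b ++ V :: H :: v].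
Proof.
elim: w => [|c w IHw]; first by constructor 1; exists 0, 0.
case: c => [[]|]; last by constructor 2; exists 0, 0, w.
  case: IHw => [[a [b ->]]|[a [b [v ->]]]|[a [b [v ->]]]].
  - by constructor 1; exists a.+1, b.
  - by constructor 2; exists a.+1, b, v.
  - by constructor 3; exists a.+1, b, v.
case: IHw => [[[|a] [b ->]]|[[|a] [b [v ->]]]|[[|a] [b [v ->]]]].
- by constructor 1; exists 0, b.+1.
- by constructor 3; exists 0, 0, (hv_word a b).
- by constructor 2; exists 0, b.+1, v.
- by constructor 3; exists 0, 0, (hv_word a b ++ D :: v).
- by constructor 3; exists 0, b.+1, v.
- by constructor 3; exists 0, 0, (hv_word a b ++ V :: H :: v).
Qed.

(** The search stops at the first D, so it succeeds exactly on the words s V H v with s = H^a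
    V^b. *)
Fixpoint descent (w : word) : option (word * word) :=
  match w with
  | V :: H :: v => Some ([::], v)
  | Some b :: w' =>
    if descent w' is Some (s, v) then Some (Some b :: s, v) else None
  | _ => None
  end.

Lemma descent_hv_word a b : descent (hv_word a b) = None.
Proof.
elim: a => [|a IHa] /=; last by rewrite -/(hv_word a b) IHa.
by elim: b => [|[|b]] //= ->.
Qed.

Lemma descent_diag a b v : descent (hv_word a b ++ D :: v) = None.
Proof.
elim: a => [|a IHa] /=; last by rewrite -/(hv_word a b) IHa.
by elim: b => [|[|b]] //= ->.
Qed.

Lemma descent_cat a b v :
  descent (hv_word a b ++ V :: H :: v) = Some (hv_word a b, v).
Proof.
elim: a => [|a IHa] /=; last by rewrite -/(hv_word a b) IHa.
by elim: b => [|[|b]] //= ->.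
Qed.

Lemma hv_word_noD a b : D \notin hv_word a b.
Proof. by rewrite mem_cat !mem_nseq !andbF. Qed.

Fixpoint inversions (w : word) : nat :=
  match w with
  | [::] => 0
  | V :: w' => count_mem H w' + inversions w'
  | _ :: w' => inversions w'
  end.

Lemma inversions_hv_word a b : inversions (hv_word a b) = 0%N.
Proof.
by elim: a => [|a IHa] //=; elim: b => [|b IHb] //=; rewrite IHb count_nseq.
Qed.

Lemma inversions_swap s v :
  inversions (s ++ V :: H :: v) = (inversions (s ++ H :: V :: v)).+1.
Proof.
elim: s => [|[[]|] s IHs] //=.
by rewrite IHs !count_cat /= addnS.
Qed.

(** The new H comes after every V of [w], and without D these are what [stepr] counts. *)
Lemma inversions_rconsH w : D \notin w ->
  inversions (rcons w H) = (inversions w + count stepr w)%N.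
Proof.
elim: w => [|[[]|] w IHw] //=; rewrite inE //= => /IHw-> //.
by rewrite -cats1 count_cat /=; lia.
Qed.

Lemma inversions_rconsV w : inversions (rcons w V) = inversions w.
Proof.
by elim: w => [|[[]|] w IHw] //=; rewrite IHw // -cats1 count_cat /= !addn0.
Qed.

Lemma count_steps w :
  (count stepl w + count stepr w = size w + count_mem D w)%N.
Proof.
by elim: w => [|[[]|] w IHw] //=; rewrite ?add0n ?add1n ?addSn ?addnS IHw.
Qed.

Lemma count_steps_noD w :
  (count stepl w + count stepr w == size w)%N = (D \notin w).
Proof.
rewrite count_steps -[X in _ == X]addn0 eqn_add2l -leqn0 leqNgt.
by rewrite -has_count has_pred1.
Qed.

(** * Faces as operations on words *)

(* The words u such that the i-th face of u has a component at w.             *)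
Fixpoint coface (i : nat) (w : word) : seq word :=
  match i, w with
  | S O, [::] => [:: [:: H]; [:: V]; [:: D]]
  | S O, D :: v => [:: H :: V :: v; V :: H :: v]
  | j.+1, c :: v => [seq c :: u | u <- coface j v]
  | _, _ => [::]
  end.

(** Counts over prefixes are the coordinates of the vertices: [w] is the path [u] with vertex [i]
    deleted. For i = 0 this is impossible, as the path must start at the origin. *)
Definition is_face (i : nat) (w u : word) :=
  [/\ size u = (size w).+1, (i <= size u)%N &
  forall j, (j <= size w)%N ->
    count stepl (take (bump i j) u) = count stepl (take j w) /\
    count stepr (take (bump i j) u) = count stepr (take j w)].

Lemma letter_eq (c c' : option bool) :
  stepl c = stepl c' :> nat -> stepr c = stepr c' :> nat -> c = c'.
Proof. by case: c => [[]|]; case: c' => [[]|]. Qed.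

Lemma word_eq (w w' : word) : size w = size w' ->
    (forall j, (j <= size w)%N ->
      count stepl (take j w) = count stepl (take j w') /\
      count stepr (take j w) = count stepr (take j w')) ->
  w = w'.
Proof.
elim: w w' => [|c w IHw] [|c' w'] //= [sw] ww'.
have [] := ww' 1 isT; rewrite /= !take0 !addn0 => cl cr.
rewrite (letter_eq cl cr) (IHw w') // => j jw.
by have [] := ww' j.+1 jw; rewrite /= cl cr => /addnI -> /addnI ->.
Qed.

Lemma is_face_cons i c w u :
  is_face i.+2 (c :: w) u <->
  exists2 u', u = c :: u' & is_face i.+1 w u'.
Proof.
split=> [[su iu uw]|[u' -> [su iu uw]]].
  case: u su iu uw => //= a u [su] iu uw.
  have [] := uw 1 isT; rewrite /= /bump /= !take0 !addn0 => al ar.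
  rewrite (letter_eq al ar); exists u => //; split=> // j jw.
  have := uw j.+1 jw; rewrite bumpS /= al ar => -[/addnI -> /addnI ->] //.
split=> //= [|[|j] jw //]; first by rewrite su.
by have [ul ur] := uw j jw; rewrite bumpS /= ul ur.
Qed.

Lemma cofaceP i w u : is_face i w u <-> u \in coface i w.
Proof.
elim: i w u => [|[|i] IHi] w u.
- split=> [[su _ uw]|]; last by case: w.
  case: u su uw => // a u _ /(_ 0 isT)[] /=.
  by rewrite !take0; case: a => [[]|].
- case: w => [|c w].
    split=> [[]|]; first by case: u => [|[[]|] [|]].
    by rewrite !inE => /or3P[] /eqP->; split=> // -[|].
  have -> : coface 1 (c :: w) =
      if c is None then [:: H :: V :: w; V :: H :: w] else [::].
    by case: c => [[]|] //; case: w.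
  split=> [[su _ uw]|].
    case: u su uw => [|a [|b u]] //= [su] uw.
    (* Deleting vertex 1 keeps the later vertices, so the tails agree and the first two steps add up
       to the single step [c], which must be D. *)
    have uw' : u = w.
      apply: word_eq => // j; rewrite su => jw; have [] := uw j.+1 jw.
      have [] := uw 1 isT; rewrite /= !take0 !addn0 !addnA => -> ->.
      by move=> /addnI -> /addnI ->.
    have [] := uw 1 isT; rewrite uw' /= !take0.
    case: c {uw} => [[]|]; case: a => [[]|]; case: b => [[]|] //=;
      by rewrite !inE eqxx ?orbT.
  case: c => [[]|] //.
  by rewrite !inE => /orP[] /eqP->; split=> //= -[|j] //= jw; rewrite ?take0.
- case: w => [|c w]; first by split=> [[] -> //|].
  apply: iff_trans (is_face_cons i c w u) _; rewrite /= -/(coface i.+1 w).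
  split=> [[u' -> /IHi]|/mapP[u' /IHi]]; first exact: map_f.
  by exists u'.
Qed.

Lemma coface_uniq i w : uniq (coface i w).
Proof.
elim: i w => [|i IHi] [|c w] //=; first by case: i {IHi}.
have cu : uniq [seq c :: u | u <- coface i w].
  by rewrite map_inj_uniq // => u u' [].
by case: i c cu {IHi} => [|i] [[]|].
Qed.

Lemma coface_noD i w : D \notin w ->
  coface i w = if i == (size w).+1 then [:: rcons w H; rcons w V; rcons w D]
               else [::].
Proof.
elim: i w => [|i IHi] [|c w] //; first by case: i {IHi}.
rewrite inE negb_or => /andP[Dc Dw].
have -> : coface i.+1 (c :: w) = [seq c :: u | u <- coface i w].
  by case: i c Dc {IHi} => [|i] [[]|].
by rewrite IHi //= eqSS; case: eqP.
Qed.

(** No step of [s] can be split: either the displayed D is split, or the change lies further right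
    and leaves s D in place. *)
Lemma mem_coface_D i s v u : D \notin s -> u \in coface i (s ++ D :: v) ->
  i = (size s).+1 /\ u \in [:: s ++ H :: V :: v; s ++ V :: H :: v]
  \/ exists v', u = s ++ D :: v'.
Proof.
elim: s i u => [|c s IHs] i u /=.
  case: i => [|[|i]] //= _; first by left.
  by case/mapP => u' _ ->; right; exists u'.
rewrite inE negb_or => /andP[Dc Ds].
case: i => [|i] //.
have -> : coface i.+1 (c :: s ++ D :: v) =
    [seq c :: u | u <- coface i (s ++ D :: v)].
  by case: i c Dc => [|i] [[]|].
case/mapP => u' /IHs[] // => [[-> u'P]|[v' ->]] ->; last by right; exists v'.
by left; move: u'P; rewrite !inE !eqseq_cons !eqxx.
Qed.

Lemma coface_D_eq s v : D \notin s ->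
  coface (size s).+1 (s ++ D :: v) = [:: s ++ H :: V :: v; s ++ V :: H :: v].
Proof.
elim: s => // c s IHs; rewrite inE negb_or => /andP[Dc Ds].
have -> : coface (size (c :: s)).+1 ((c :: s) ++ D :: v) =
    [seq c :: u | u <- coface (size s).+1 (s ++ D :: v)] by [].
by rewrite IHs.
Qed.
Arguments coface : simpl never.

(** * Shuffle indices as words *)

Section DsurjValues.

Variables (n : nat) (f : Dsurj n).

Lemma dsurj0 : f ord0 = 0%N :> nat.
Proof.
have /surjP/(_ ord0)[i fi] := dsurjP f; apply/eqP; rewrite -leqn0.
by rewrite -[X in (_ <= X)%N]/(val (@ord0 (dtgt f))) -fi dmap_le.
Qed.

Lemma dsurj_max : f ord_max = dtgt f :> nat.
Proof.
have /surjP/(_ ord_max)[i fi] := dsurjP f; apply/eqP.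
rewrite eqn_leq -ltnS ltn_ord /=.
by rewrite -[X in (X <= _)%N]/(val (@ord_max (dtgt f))) -fi dmap_le ?leq_ord.
Qed.

Lemma dsurjS (i j : 'I_n.+1) : j = i.+1 :> nat -> (f j <= (f i).+1)%N.
Proof.
move=> ji; rewrite leqNgt; apply/negP => fij.
have fk : ((f i).+1 < (dtgt f).+1)%N by rewrite (ltn_trans fij).
have /surjP/(_ (Ordinal fk))[h /(congr1 val) /= fh] := dsurjP f.
have [hi|ih] := leqP h i; first by have := dmap_le f hi; lia.
have jh : (j <= h)%N by rewrite ji.
by have := dmap_le f jh; lia.
Qed.

End DsurjValues.

Lemma count_take_surj (T : Type) (a : pred T) (s : seq T) k :
  (k <= count a s)%N -> exists2 j, (j <= size s)%N & count a (take j s) = k.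
Proof.
elim: s k => [|c s IHs] k /=; first by rewrite leqn0 => /eqP->; exists 0%N.
have [->|k0] := eqVneq k 0%N; first by exists 0%N.
move=> kc; have [|j js jk] := IHs (k - a c)%N; first by lia.
by exists j.+1 => //=; rewrite jk; case: (a c) kc; lia.
Qed.

Lemma cumulative_Dsurj n (T : Type) (a : pred T) (s : seq T) : size s = n ->
  exists f : Dsurj n, forall j : 'I_n.+1, f j = count a (take j s) :> nat.
Proof.
move=> sn; have kn : (count a s < n.+1)%N by rewrite ltnS -sn count_size.
have le_take i j : (i <= j)%N -> (count a (take i s) <= count a (take j s))%N.
  by move=> ij; rewrite -(subnKC ij) takeD count_cat leq_addr.
have lt_take j : (count a (take j s) < (count a s).+1)%N.
  by rewrite ltnS -{2}(cat_take_drop j s) count_cat leq_addr.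
pose f (j : 'I_n.+1) : 'I_(count a s).+1 := Ordinal (lt_take j).
have fm : monotone (finfun f) by apply: monotoneP => i j; exact: le_take.
have fs : surj (DMap fm).
  apply/surjP => k; have := ltn_ord k; rewrite ltnS.
  case/count_take_surj=> j js jk.
  have jn : (j < n.+1)%N by rewrite ltnS -sn.
  by exists (Ordinal jn); rewrite ffunE; apply: val_inj.
by exists (@DSurj n (Ordinal kn) _ fs) => j; rewrite /= ffunE.
Qed.

Section ShuffleWord.

Variable n : nat.
Implicit Types p q : shuffle_index n.

(** The default V is correct because joint injectivity makes some coordinate grow at every step. *)
Definition shuffle_word p : word :=
  mkseq (fun i =>
    if (shl p (inord i) < shl p (inord i.+1))%N then
      if (shr p (inord i) < shr p (inord i.+1))%N then D else H
    else V) n.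

Lemma size_shuffle_word p : size (shuffle_word p) = n.
Proof. exact: size_mkseq. Qed.

Lemma shuffle_word_shl p (j : 'I_n.+1) :
  count stepl (take j (shuffle_word p)) = shl p j.
Proof.
case: j => j /=; elim: j => [|j IHj] jn.
  rewrite take0; have -> : Ordinal jn = ord0 by exact: val_inj.
  by rewrite dsurj0.
have jn' : (j < n.+1)%N by exact: ltnW.
rewrite (take_nth V) ?size_shuffle_word // -cats1 count_cat (IHj jn') /=.
rewrite nth_mkseq // addn0.
have -> : inord j = Ordinal jn' by apply: val_inj; rewrite /= inordK.
have -> : inord j.+1 = Ordinal jn by apply: val_inj; rewrite /= inordK.
have := @dsurjS _ (shl p) (Ordinal jn') (Ordinal jn) erefl.
have := @dmap_le _ _ (shl p) (Ordinal jn') (Ordinal jn) (leqnSn j).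
by case: (ltnP (shl p _) _) => [|] /= ? ? ?; last lia; case: ifP => _ /=; lia.
Qed.

Lemma shuffle_word_shr p (j : 'I_n.+1) :
  count stepr (take j (shuffle_word p)) = shr p j.
Proof.
case: j => j /=; elim: j => [|j IHj] jn.
  rewrite take0; have -> : Ordinal jn = ord0 by exact: val_inj.
  by rewrite dsurj0.
have jn' : (j < n.+1)%N by exact: ltnW.
rewrite (take_nth V) ?size_shuffle_word // -cats1 count_cat (IHj jn') /=.
rewrite nth_mkseq // addn0.
have -> : inord j = Ordinal jn' by apply: val_inj; rewrite /= inordK.
have -> : inord j.+1 = Ordinal jn by apply: val_inj; rewrite /= inordK.
have := @dsurjS _ (shr p) (Ordinal jn') (Ordinal jn) erefl.
have := @dmap_le _ _ (shr p) (Ordinal jn') (Ordinal jn) (leqnSn j).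
have := @dmap_le _ _ (shl p) (Ordinal jn') (Ordinal jn) (leqnSn j).
case: (ltnP (shl p _) _) => [|le1] ? le2 ?; first by case: ltnP => /=; lia.
rewrite /=; case: (ltnP (shr p (Ordinal jn')) (shr p (Ordinal jn))); first lia.
move=> le3; have /injectiveP p_inj := shuffle_inj p.
have el : shl p (Ordinal jn') = shl p (Ordinal jn) by apply: ord_inj; lia.
have er : shr p (Ordinal jn') = shr p (Ordinal jn) by apply: ord_inj; lia.
have := p_inj (Ordinal jn') (Ordinal jn); rewrite /= el er.
by move=> /(_ erefl)/(congr1 (@nat_of_ord _)) /=; lia.
Qed.

Lemma dtgt_shl p : dtgt (shl p) = count stepl (shuffle_word p) :> nat.
Proof.
by rewrite -dsurj_max -shuffle_word_shl /= take_oversize ?size_shuffle_word.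
Qed.

Lemma dtgt_shr p : dtgt (shr p) = count stepr (shuffle_word p) :> nat.
Proof.
by rewrite -dsurj_max -shuffle_word_shr /= take_oversize ?size_shuffle_word.
Qed.

Lemma shuffle_word_inj : injective shuffle_word.
Proof.
move=> p q pq; apply: shuffle_index_eq; apply: Dsurj_eq.
- by rewrite !dtgt_shl pq.
- by move=> i; rewrite -!shuffle_word_shl pq.
- by rewrite !dtgt_shr pq.
- by move=> i; rewrite -!shuffle_word_shr pq.
Qed.

Lemma shuffle_word_surj w : size w = n -> exists p, shuffle_word p = w.
Proof.
move=> wn; have [f fE] := cumulative_Dsurj stepl wn.
have [g gE] := cumulative_Dsurj stepr wn.
have fg : injectiveb (fun i => (f i, g i)).
  (* Every letter advances a coordinate, so the sum of the coordinates is strictly increasing. *)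
  have mono (i j : 'I_n.+1) : (i < j)%N -> (f i + g i < f j + g j)%N.
    move=> ij; rewrite !fE !gE !count_steps.
    rewrite !size_take wn; have := ltn_ord i; have := ltn_ord j; rewrite !ltnS.
    rewrite -(subnKC (ltnW ij)) takeD count_cat.
    by case: (ltnP i n); case: (ltnP (i + (j - i)) n); lia.
  apply/injectiveP => i j [fij gij]; apply: ord_inj.
  by have [/mono|/mono|//] := ltngtP i j; rewrite fij gij ltnn.
exists (ShuffleIndex fg); apply: word_eq; rewrite size_shuffle_word // => j jn.
have jn' : (j < n.+1)%N by rewrite ltnS.
have := shuffle_word_shl (ShuffleIndex fg) (Ordinal jn').
have := shuffle_word_shr (ShuffleIndex fg) (Ordinal jn').
by rewrite /= fE gE.
Qed.

End ShuffleWord.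

Lemma is_faceP n (i : 'I_n.+2) (p : shuffle_index n) (q : shuffle_index n.+1) :
  is_face i (shuffle_word p) (shuffle_word q) <->
  (forall j, shl q (fintype.lift i j) = shl p j :> nat) /\
  (forall j, shr q (fintype.lift i j) = shr p j :> nat).
Proof.
split=> [[_ _ qp]|[lqp rqp]].
  split=> j.
    rewrite -!shuffle_word_shl.
    by have [] := qp j _; rewrite ?size_shuffle_word ?leq_ord.
  rewrite -!shuffle_word_shr.
  by have [] := qp j _; rewrite ?size_shuffle_word ?leq_ord.
split; rewrite ?size_shuffle_word ?leq_ord // => j jn.
have jn' : (j < n.+1)%N by rewrite ltnS.
have := lqp (Ordinal jn'); have := rqp (Ordinal jn').
by rewrite -!shuffle_word_shl -!shuffle_word_shr /= => -> ->.
Qed.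

(** * Matrix entries of the Dold-Kan faces *)

Fact dincl_subproof k l :
  monotone (finfun (fun j : 'I_k.+1 => inord (minn j l) : 'I_l.+1)).
Proof.
by apply: monotoneP => i j ij; rewrite !inordK ?ltnS ?geq_minr //; lia.
Qed.

(* The initial segment inclusion, truncated at l when k > l.                  *)
Definition dincl k l : Dmap k l := DMap (dincl_subproof k l).

Lemma dinclE k l (j : 'I_k.+1) : (k <= l)%N -> dincl k l j = j :> nat.
Proof.
move=> kl; rewrite ffunE inordK ?ltnS ?geq_minr //.
by have := ltn_ord j; lia.
Qed.

Lemma dincl_inj k l : (k <= l)%N -> injective (dincl k l).
Proof.
by move=> kl i j /(congr1 (@nat_of_ord _)); rewrite !dinclE // => /ord_inj.
Qed.

Section DoldKanStep.

Variables (S : pzRingType) (X : complex S).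

Lemma DKface_dincl_id k x : DKface (X := X) (dincl k k) x = x.
Proof. exact: DKface_endo. Qed.

Lemma dincl_delta k : dincl k k.+1 = delta ord_max.
Proof.
apply: dmapP => j; apply: ord_inj; rewrite dinclE // deltaE /=.
by rewrite /bump leqNgt ltn_ord.
Qed.

Lemma DKface_dincl_d k x :
  DKface (X := X) (dincl k k.+1) x = (-1) ^+ k.+1 *: cx_d X k x.
Proof. by rewrite DKface_delta dincl_delta eqxx. Qed.

(** An injection with nonzero [DKface] is an initial segment inclusion, so the search for [iota]
    reduces to comparing [f] with [g] off the vertex [i]. *)
Lemma DKentry_delta n (i : 'I_n.+2) (f : Dsurj n) (g : Dsurj n.+1) x :
  @DKentry S X n n.+1 (delta i) f g x =
  if [forall j, g (fintype.lift i j) == f j :> nat]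
  then DKface (dincl (dtgt f) (dtgt g)) x else 0.
Proof.
have /surjP f_surj := dsurjP f.
rewrite /DKentry; case: pickP => [iota /andP[/injectiveP ii /eqP gf]|no_iota].
  have gfE j : g (fintype.lift i j) = iota (f j).
    by rewrite -deltaE -dcompE gf dcompE.
  case: ifP => [/forallP gi|/forallP gi].
    congr (DKface _ x); apply: dmapP => k; apply: ord_inj.
    have [j <-] := f_surj k.
    by rewrite dinclE ?(dmap_inj_le ii) // -(eqP (gi j)) gfE.
  have iota_neq : ~ forall j, iota j = j :> nat.
    by move=> iE; apply: gi => j; rewrite gfE iE.
  move: (iota) iota_neq ii => {gfE gf gi} iota'.
  move: (nat_of_ord (dtgt f)) (nat_of_ord (dtgt g)) x iota' => k l x iota'.
  move=> ne ii.
  have [kl|lk|kl] := ltngtP k.+1 l; first exact: DKface_gap.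
    have e : k = l by have := dmap_inj_le ii; lia.
    by subst l; case: ne => j; rewrite (dmap_inj_endo ii) didE.
  subst l; rewrite DKface_delta; case: eqP => // e; case: ne => j.
  by rewrite e deltaE /= /bump leqNgt ltn_ord.
case: ifP => // /forallP gi.
have kl : (dtgt f <= dtgt g)%N.
  by have [j /(congr1 (@nat_of_ord _)) /= <-] := f_surj ord_max;
     rewrite -(eqP (gi j)) leq_ord.
have /negP[] := no_iota (dincl (dtgt f) (dtgt g)).
apply/andP; split; first exact/injectiveP/dincl_inj.
apply/eqP/dmapP => j; apply: ord_inj; rewrite !dcompE dinclE // deltaE.
by rewrite (eqP (gi j)).
Qed.

(* The identity transported along k = l, and zero when k != l.                *)
Definition retype k l : X k -> X l :=
  if k =P l is ReflectT e then ecast l (X k -> X l) e id else fun=> 0.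

Fact retype_is_linear k l : linear (@retype k l).
Proof.
rewrite /retype; case: eqP => [e|_] a x y; first by case: _ / e.
by rewrite scaler0 addr0.
Qed.

HB.instance Definition _ k l :=
  GRing.isLinear.Build S (X k) (X l) _ (@retype k l) (@retype_is_linear k l).

Lemma retype_id k x : @retype k k x = x.
Proof. by rewrite /retype; case: eqP => // e; rewrite eq_axiomK. Qed.

Lemma retype_neq k l x : k != l -> @retype k l x = 0.
Proof. by rewrite /retype; case: eqP. Qed.

End DoldKanStep.

(** * Components at words, and the differential in terms of them *)

Section Components.

Variables (R : pzRingType) (X : complex R^c) (Y : complex R).

Local Notation sh := (shuffle_complex X Y).

(* Zero unless w is a path of length n to (k, l). Leaving k and l free of w   *)
(* avoids transports between the modules of words with the same endpoint.     *)
Definition wcomp n (w : word) k l (t : sh n) : tens (X k) (Y l) :=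
  \sum_(p : shuffle_index n | shuffle_word p == w)
    tens_map (@retype _ X (dtgt (shl p)) k) (@retype _ Y (dtgt (shr p)) l)
      (t p).

Fact wcomp_is_zmod_morphism n w k l : zmod_morphism (@wcomp n w k l).
Proof.
move=> s t; rewrite /wcomp -sumrB; apply: eq_bigr => p _.
by rewrite dsumBE raddfB.
Qed.

HB.instance Definition _ n w k l :=
  GRing.isZmodMorphism.Build (sh n) (tens (X k) (Y l)) (@wcomp n w k l)
    (@wcomp_is_zmod_morphism n w k l).

Lemma wcomp_shuffle_word n (p : shuffle_index n) (t : sh n) :
  wcomp (shuffle_word p) (dtgt (shl p)) (dtgt (shr p)) t = t p.
Proof.
rewrite /wcomp (big_pred1 p) => [|q]; last first.
  exact: (inj_eq (@shuffle_word_inj n)).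
by rewrite -[RHS]tens_map_id; apply: eq_tens_map => x; exact: retype_id.
Qed.

Lemma wcomp0 n w k l (t : sh n) :
    ~~ (path_to n w k l) ->
  wcomp w k l t = 0.
Proof.
move=> wkl; apply: big1 => p /eqP pw; move: wkl.
rewrite -pw size_shuffle_word eqxx -dtgt_shl -dtgt_shr /= negb_and => /orP[] ne.
  by apply: tens_map0l => x; exact: retype_neq.
by apply: tens_map0r => x; exact: retype_neq.
Qed.

Variant wcomp_spec (n : nat) (w : word) (k l : nat) : Prop :=
  | CompSpec (p : shuffle_index n) of
      w = shuffle_word p & k = dtgt (shl p) & l = dtgt (shr p).

Lemma wcompP n w k l :
  reflect (wcomp_spec n w k l) (path_to n w k l).
Proof.
apply: (iffP and3P) => [[/eqP wn /eqP <- /eqP <-]|[p -> -> ->]].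
  have [p pw] := shuffle_word_surj wn.
  by exists p; rewrite ?dtgt_shl ?dtgt_shr pw.
by rewrite size_shuffle_word dtgt_shl dtgt_shr.
Qed.

Lemma wcomp_eq n (s t : sh n) :
  (forall w k l, wcomp w k l s = wcomp w k l t) -> s = t.
Proof. by move=> st; apply/dsumP => p; rewrite -!wcomp_shuffle_word st. Qed.

Definition of_wcomp n (c : word -> forall k l, tens (X k) (Y l)) : sh n :=
  finfun (fun p : shuffle_index n =>
    c (shuffle_word p) (dtgt (shl p)) (dtgt (shr p))).

Lemma of_wcompE n (c : word -> forall k l, tens (X k) (Y l)) w k l :
    path_to n w k l ->
  wcomp w k l (of_wcomp n c) = c w k l.
Proof. by case/wcompP => p -> -> ->; rewrite wcomp_shuffle_word ffunE. Qed.

Lemma shuffle_dE n (t : sh n.+1) (p : shuffle_index n) :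
  shuffle_d t p = \sum_(i < n.+2) (\sum_(q : shuffle_index n.+1)
     tens_map (@DKentry _ X _ _ (delta i) (shl p) (shl q))
       (@DKentry _ Y _ _ (delta i) (shr p) (shr q)) (t q)) *~ (-1) ^+ i.
Proof.
rewrite ffunE /DKtens_d raddf_sum; apply: eq_bigr => i _.
rewrite raddfMz /= /shuffle_incl !raddf_sum /=; congr (_ *~ _).
apply: eq_bigr => q _; rewrite !tens_map_comp.
by apply: eq_tens_map => x /=; exact: lmatrix_inj.
Qed.

(** The entry of face [i] from q to p vanishes unless both coordinates of q restrict to those of p
    off vertex [i], that is, unless the word of q is in [coface i w]. *)
Lemma shuffle_d_coface n (t : sh n.+1) w k l :
    path_to n w k l ->
  wcomp w k l (zcx_d sh n t) = \sum_(i < n.+2) (\sum_(u <- coface i w)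
     tens_map (DKface (X := X) (dincl k (count stepl u)))
       (DKface (X := Y) (dincl l (count stepr u)))
       (wcomp u (count stepl u) (count stepr u) t)) *~ (-1) ^+ i.
Proof.
case/wcompP => p -> -> ->; rewrite wcomp_shuffle_word shuffle_dE.
apply: eq_bigr => i _; congr (_ *~ _).
rewrite [RHS](eq_bigr (fun u =>
  \sum_(q : shuffle_index n.+1 | shuffle_word q == u)
    tens_map (DKface (X := X) (dincl (dtgt (shl p)) (dtgt (shl q))))
      (DKface (X := Y) (dincl (dtgt (shr p)) (dtgt (shr q)))) (t q)));
  last first.
  move=> u _; rewrite /wcomp raddf_sum; apply: eq_bigr => q /eqP <-.
  rewrite -dtgt_shl -dtgt_shr [LHS]tens_map_comp.
  by apply: eq_tens_map => x /=; rewrite retype_id.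
rewrite (exchange_big_dep predT) //=; apply: eq_bigr => q _.
rewrite [RHS](eq_bigl (pred1 (shuffle_word q))) => [|u]; last exact: eq_sym.
have [qi|qi] := boolP (shuffle_word q \in coface i (shuffle_word p)).
  rewrite -[RHS]big_filter filter_pred1_uniq ?coface_uniq // big_seq1.
  have [lqp rqp] := iffLR (is_faceP i p q) (iffRL (cofaceP _ _ _) qi).
  apply: eq_tens_map => x /=; rewrite DKentry_delta ifT //; apply/forallP => j.
    by rewrite lqp.
  by rewrite rqp.
rewrite [RHS]big1_seq => [|u /andP[/eqP-> ui]]; last by rewrite ui in qi.
have [lqp|lqp] := boolP [forall j, shl q (fintype.lift i j) == shl p j :> nat].
  apply: tens_map0r => x /=; rewrite DKentry_delta ifF //; apply/negP => rqp.
  by case/negP: qi; apply/cofaceP/is_faceP; split=> j; apply/eqP;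
    [exact: (forallP lqp)|exact: (forallP rqp)].
by apply: tens_map0l => x /=; rewrite DKentry_delta (negbTE lqp).
Qed.

End Components.

Section TensorSign.

Variables (R : pzRingType) (M : lmodType R^c) (N : lmodType R).

Lemma tensorNl (x : M) (y : N) : tensor (- x) y = - tensor x y.
Proof. by apply/eqP; rewrite -addr_eq0 -tensorDl addNr tensor0l. Qed.

Lemma tensorNr (x : M) (y : N) : tensor x (- y) = - tensor x y.
Proof. by apply/eqP; rewrite -addr_eq0 -tensorDr addNr tensor0r. Qed.

End TensorSign.

Section TensorMapSign.

Variables (R : pzRingType) (M M' : lmodType R^c) (N N' : lmodType R).

(** Turns the Dold-Kan signs, which are scalars of the ring, into integer multiples like the signs
    of the alternating sums. *)
Lemma tens_map_signl m (f f' : {linear M -> M'}) (g g' : {linear N -> N'}) t :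
    (forall x, f x = (-1) ^+ m *: f' x) -> g =1 g' ->
  tens_map f g t = tens_map f' g' t *~ (-1) ^+ m.
Proof.
move=> ff' gg'; elim/tens_ind: t => [u v Pu Pv|x y].
  by rewrite !raddfB /= Pu Pv mulrzBl.
rewrite !tens_map_tensor ff' gg' -signr_odd -[(-1) ^+ m in RHS]signr_odd.
case: (odd m); rewrite ?expr0 ?expr1 ?scale1r ?mulr1z //.
by rewrite scaleN1r tensorNl mulrN1z.
Qed.

Lemma tens_map_signr m (f f' : {linear M -> M'}) (g g' : {linear N -> N'}) t :
    f =1 f' -> (forall y, g y = (-1) ^+ m *: g' y) ->
  tens_map f g t = tens_map f' g' t *~ (-1) ^+ m.
Proof.
move=> ff' gg'; elim/tens_ind: t => [u v Pu Pv|x y].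
  by rewrite !raddfB /= Pu Pv mulrzBl.
rewrite !tens_map_tensor ff' gg' -signr_odd -[(-1) ^+ m in RHS]signr_odd.
case: (odd m); rewrite ?expr0 ?expr1 ?scale1r ?mulr1z //.
by rewrite scaleN1r tensorNr mulrN1z.
Qed.

End TensorMapSign.

(** * The differential at words s D v and at D-free words *)

Section Rows.

Variables (R : pzRingType) (X : complex R^c) (Y : complex R).

Local Notation sh := (shuffle_complex X Y).

Lemma tens_map_dincl_id n (t : sh n) u k l k' l' : k' = k -> l' = l ->
  tens_map (DKface (X := X) (dincl k k')) (DKface (X := Y) (dincl l l'))
    (wcomp u k' l' t) = wcomp u k l t.
Proof.
move=> -> ->; rewrite -[RHS]tens_map_id.
by apply: eq_tens_map => x; exact: DKface_dincl_id.
Qed.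

(** Splitting anything but the first D leaves a word starting with s D, where [t] vanishes. *)
Lemma wcomp_d_diag n (t : sh n.+1) s v k l :
    D \notin s -> (forall v' k' l', wcomp (s ++ D :: v') k' l' t = 0) ->
  wcomp (s ++ D :: v) k l (zcx_d sh n t) =
  (wcomp (s ++ H :: V :: v) k l t + wcomp (s ++ V :: H :: v) k l t)
    *~ (-1) ^+ (size s).+1.
Proof.
move=> Ds t0.
have [wkl|nwkl] := boolP (path_to n (s ++ D :: v) k l); last first.
  rewrite !wcomp0 ?addr0 ?mul0rz //; apply: contra nwkl;
    by rewrite !size_cat !count_cat /=; lia.
rewrite shuffle_d_coface //.
have [wn wk wl] := and3P wkl.
have sn : ((size s).+1 < n.+2)%N by rewrite -(eqP wn) size_cat /= ltnS; lia.
rewrite (bigD1 (Ordinal sn)) //= [X in _ + X = _]big1 => [|i i_neq].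
  rewrite addr0 coface_D_eq //.
  rewrite big_cons big_seq1; congr (_ *~ _).
  by rewrite !tens_map_dincl_id // -?(eqP wk) -?(eqP wl) !count_cat /=; lia.
rewrite big1_seq ?mul0rz // => u /= /mem_coface_D[] // => [[iE _]|[v' ->]].
  by case/eqP: i_neq; apply: ord_inj.
by rewrite t0 raddf0.
Qed.

(** Interior faces create a D, so only the last face contributes. Its sign (-1)^(n+1) combines with
    the Dold-Kan sign (-1)^(k+1) or (-1)^(l+1). *)
Lemma wcomp_d_noD n (t : sh n.+1) w k l :
    D \notin w -> wcomp (rcons w D) k.+1 l.+1 t = 0 ->
    path_to n w k l ->
  wcomp w k l (zcx_d sh n t) =
  tens_map (cx_d X k) idfun (wcomp (rcons w H) k.+1 l t) *~ (-1) ^+ (n + k)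
  + tens_map idfun (cx_d Y l) (wcomp (rcons w V) k l.+1 t) *~ (-1) ^+ (n + l).
Proof.
move=> Dw tD wkl; rewrite shuffle_d_coface //.
have [/eqP wn /eqP wk /eqP wl] := and3P wkl.
rewrite big_ord_recr /= big1 ?add0r => [|i _]; last first.
  by rewrite coface_noD // wn ltn_eqF ?big_nil ?mul0rz.
rewrite coface_noD // wn eqxx !big_cons big_nil addr0.
have cl c : count stepl (rcons w c) = (k + stepl c)%N.
  by rewrite -cats1 count_cat wk /= addn0.
have cr c : count stepr (rcons w c) = (l + stepr c)%N.
  by rewrite -cats1 count_cat wl /= addn0.
rewrite !{}cl !{}cr /= !addn0 !addn1 tD raddf0 addr0 mulrzDl.
rewrite (tens_map_signl (m := k.+1) (f' := cx_d X k) (g' := idfun));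
  last 2 first.
- by move=> x; exact: DKface_dincl_d.
- by move=> x; exact: DKface_dincl_id.
rewrite (tens_map_signr (m := l.+1) (f' := idfun) (g' := cx_d Y l));
  last 2 first.
- by move=> x; exact: DKface_dincl_id.
- by move=> x; exact: DKface_dincl_d.
rewrite -!mulrzA -!exprD !addSnnS !addnS !exprS !mulN1r !opprK.
by rewrite ![(_ + n)%N]addnC.
Qed.

End Rows.

(** * The chain map [nabla] *)

Section Nabla.

Variables (R : pzRingType) (X : complex R^c) (Y : complex R).

Local Notation tc := (tensor_complex X Y).
Local Notation sh := (shuffle_complex X Y).

(** The zero off k + l = n is what makes [nabla_fun] vanish at words containing D. *)
Definition tcomp n k l (t : tc n) : tens (X k) (Y l) :=
  if @idP (k + l == n)%N is ReflectT e then t (Bideg e) else 0.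

Lemma tcomp_bideg n (p : bideg n) (t : tc n) : tcomp (bdl p) (bdr p) t = t p.
Proof.
rewrite /tcomp; case: {-}_ / idP => [e|]; last by rewrite bideg_sum.
by case: p e => k l kl e; congr (t (Bideg _)); exact: bool_irrelevance.
Qed.

Lemma tcomp0 n k l (t : tc n) : (k + l)%N != n -> tcomp k l t = 0.
Proof. by move=> /negP kl; rewrite /tcomp; case: {-}_ / idP. Qed.

Fact tcomp_is_zmod_morphism n k l : zmod_morphism (@tcomp n k l).
Proof.
move=> s t; rewrite /tcomp; case: {-}_ / idP => [e|_]; last by rewrite subr0.
by rewrite dsumBE.
Qed.

HB.instance Definition _ n k l :=
  GRing.isZmodMorphism.Build (tc n) (tens (X k) (Y l)) (@tcomp n k l)
    (@tcomp_is_zmod_morphism n k l).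

Lemma tcomp_d n k l (t : tc n.+1) : (k + l)%N = n ->
  tcomp k l (zcx_d tc n t) =
  tens_map (cx_d X k) idfun (tcomp k.+1 l t)
  + tens_map idfun (cx_d Y l) (tcomp k l.+1 t) *~ (-1) ^+ k.
Proof.
move=> /eqP kl; pose p := Bideg kl.
rewrite -[k]/(bdl p) -[l]/(bdr p) tcomp_bideg ffunE.
by rewrite -(tcomp_bideg (bidegSl p)) -(tcomp_bideg (bidegSr p)).
Qed.

Definition nabla_fun n (t : tc n) : sh n :=
  of_wcomp n (fun w k l => tcomp k l t *~ (-1) ^+ inversions w).

Fact nabla_is_zmod_morphism n : zmod_morphism (@nabla_fun n).
Proof.
by move=> s t; apply/dsumP => p; rewrite dsumBE !ffunE raddfB mulrzBl.
Qed.

HB.instance Definition _ n :=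
  GRing.isZmodMorphism.Build (tc n) (sh n) (@nabla_fun n)
    (@nabla_is_zmod_morphism n).

Lemma wcomp_nabla n w k l (t : tc n) :
    path_to n w k l ->
  wcomp w k l (nabla_fun t) = tcomp k l t *~ (-1) ^+ inversions w.
Proof. exact: of_wcompE. Qed.

Lemma wcomp_nabla_D n w k l (t : tc n) :
  D \in w -> wcomp w k l (nabla_fun t) = 0.
Proof.
move=> Dw; have [wkl|/wcomp0-> //] := boolP (path_to n w k l).
rewrite wcomp_nabla // tcomp0 ?mul0rz //.
by case/and3P: wkl => /eqP<- /eqP<- /eqP<-; rewrite count_steps_noD Dw.
Qed.

Lemma wcomp_nabla_swap n s v k l (t : tc n) :
  wcomp (s ++ H :: V :: v) k l (nabla_fun t)
  + wcomp (s ++ V :: H :: v) k l (nabla_fun t) = 0.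
Proof.
set w := s ++ H :: V :: v; set w' := s ++ V :: H :: v.
have e (P : pred _) : count P w' = count P w.
  by rewrite !count_cat /= [(P V + _)%N]addnCA.
have sz : size w' = size w by rewrite !size_cat.
have [wkl|nwkl] := boolP (path_to n w k l).
  rewrite !wcomp_nabla ?sz ?e // inversions_swap exprS mulN1r mulrNz.
  exact: subrr.
by rewrite !wcomp0 ?sz ?e // addr0.
Qed.

Lemma split_first_D (w : word) :
  D \in w -> exists s v : word, D \notin s /\ w = s ++ D :: v.
Proof.
elim: w => // -[b|] w IHw; last by exists [::], w.
rewrite inE => /IHw[s [v [Ds ->]]]; exists (Some b :: s), v.
by rewrite inE.
Qed.

Lemma nabla_d n (t : tc n.+1) :
  nabla_fun (zcx_d tc n t) = zcx_d sh n (nabla_fun t).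
Proof.
apply: wcomp_eq => w k l.
(* At a word with a D only the splitting of its first D contributes, and the two resulting words
   cancel. *)
have [/split_first_D[s [v [Ds ->]]]|Dw] := boolP (D \in w).
  rewrite wcomp_d_diag // => [|v' k' l']; last first.
    by rewrite wcomp_nabla_D // mem_cat inE eqxx orbT.
  rewrite wcomp_nabla_swap mul0rz wcomp_nabla_D //.
  by rewrite mem_cat inE eqxx orbT.
have [wkl|nwkl] := boolP (path_to n w k l);
  last by rewrite !wcomp0.
have [/eqP wn /eqP wk /eqP wl] := and3P wkl.
have kl : (k + l = n)%N.
  by apply/eqP; rewrite -wn -wk -wl count_steps_noD.
rewrite wcomp_d_noD //; last by rewrite wcomp_nabla_D // mem_rcons inE eqxx.
rewrite !wcomp_nabla // ?size_rcons -?cats1 ?count_cat /= ?wn ?wk ?wl;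
  rewrite ?addn0 ?addn1 ?eqxx //.
rewrite !cats1 inversions_rconsH // inversions_rconsV wl tcomp_d //.
rewrite !raddfMz /= mulrzDl.
(* Modulo 2, with k + l = n: appending H adds l inversions, and l + n + k is even; appending V adds
   none, and n + l is k, the Koszul sign. *)
rewrite -!mulrzA -!exprD; congr (_ *~ _ + _ *~ _);
  rewrite -signr_odd -[RHS]signr_odd; congr (_ ^+ nat_of_bool _);
  by rewrite -kl !oddD; case: (odd k); case: (odd l);
     case: (odd (inversions w)).
Qed.

Definition nabla : zmorph tc sh := @ZMorph _ _ (fun n => @nabla_fun n) nabla_d.

(** * Injectivity and image of [nabla] *)

Lemma hv_word_steps n a b : (a + b == n)%N ->
  path_to n (hv_word a b) a b.
Proof.
move=> /eqP<-; rewrite size_cat !size_nseq !count_cat !count_nseq /=.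
by rewrite !mul1n !mul0n addn0 !eqxx.
Qed.

Lemma nabla_inj n : injective (nabla n).
Proof.
move=> s t st; apply/dsumP => p; rewrite -!tcomp_bideg.
have := congr1 (wcomp (hv_word (bdl p) (bdr p)) (bdl p) (bdr p)) st.
by rewrite !wcomp_nabla ?hv_word_steps ?bideg_sum // inversions_hv_word !mulr1z.
Qed.

(* Solves u(s V H v) = +- z(s D v) - u(s H V v), where m exceeds the number   *)
(* of inversions of w.                                                        *)
Fixpoint diag_filling n (z : sh n) (m : nat) (w : word) k l :
    tens (X k) (Y l) :=
  if m is m'.+1 then
    if descent w is Some (s, v) then
      wcomp (s ++ D :: v) k l z *~ (-1) ^+ (size s).+1
      - diag_filling z m' (s ++ H :: V :: v) k l
    else 0
  else 0.

(** Take [u] supported on the words s V H v. Then [wcomp_d_diag] applies to [u], and the condition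
    at s D v expresses u(s V H v) through u(s H V v), which has one inversion less. *)
Lemma kill_diag n (z : sh n) : exists u : sh n.+1, forall a b v k l,
  wcomp (hv_word a b ++ D :: v) k l (z - zcx_d sh n u) = 0.
Proof.
pose u : sh n.+1 := of_wcomp n.+1 (fun w => diag_filling z (inversions w).+1 w).
have u0 w k l : descent w = None -> wcomp w k l u = 0.
  move=> dw; have [wkl|/wcomp0-> //] := boolP (path_to n.+1 w k l).
  by rewrite of_wcompE //= dw.
exists u => a b v k l; set s := hv_word a b.
have [wkl|/wcomp0-> //] := boolP (path_to n (s ++ D :: v) k l).
have wkl1 : path_to n.+1 (s ++ H :: V :: v) k l.
  by move: wkl; rewrite !size_cat !count_cat /=; lia.
have wkl2 : path_to n.+1 (s ++ V :: H :: v) k l.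
  by move: wkl; rewrite !size_cat !count_cat /=; lia.
rewrite raddfB /= wcomp_d_diag ?hv_word_noD // => [|v' k' l']; last first.
  by rewrite u0 ?descent_diag.
have -> : wcomp (s ++ V :: H :: v) k l u =
    wcomp (s ++ D :: v) k l z *~ (-1) ^+ (size s).+1
    - wcomp (s ++ H :: V :: v) k l u.
  (* The extra inversion of s V H v is the one level of recursion spent here; the rest is the depth
     that [u] uses at s H V v. *)
  rewrite !of_wcompE // inversions_swap.
  by move: (inversions _).+1 => m /=; rewrite descent_cat.
rewrite addrCA subrr addr0 -mulrzA -exprD addnn -mul2n exprM sqrrN expr1n.
by rewrite mulr1z subrr.
Qed.

(** Both sides agree at H^a V^b by the choice of [t] and vanish at s D v; at s V H v the sign rule
    reduces to s H V v, by induction on inversions. *)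
Lemma nabla_image n (c : sh n) :
    (forall a b v k l, wcomp (hv_word a b ++ D :: v) k l c = 0) ->
    (forall a b v k l, wcomp (hv_word a b ++ H :: V :: v) k l c
                       + wcomp (hv_word a b ++ V :: H :: v) k l c = 0) ->
  exists t, c = nabla n t.
Proof.
move=> cD cS.
pose t : tc n := finfun (fun p : bideg n =>
  wcomp (hv_word (bdl p) (bdr p)) (bdl p) (bdr p) c).
exists t; apply: wcomp_eq => w; have [m] := ubnP (inversions w).
elim: m w => // m IHm w wm k l.
case: (word_trichotomy w) wm =>
  [[a [b ->]] _|[a [b [v ->]]] _|[a [b [v ->]]] wm].
- have [wkl|nwkl] := boolP (path_to n (hv_word a b) k l); last first.
    by rewrite !wcomp0.
  have := wkl; have := hv_word_steps (eqxx (a + b)%N).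
  case/and3P=> /eqP-> /eqP-> /eqP-> /and3P[ab /eqP ak /eqP bl].
  rewrite wcomp_nabla // inversions_hv_word mulr1z -ak -bl.
  by rewrite -[a]/(bdl (Bideg ab)) -[b]/(bdr (Bideg ab)) tcomp_bideg ffunE.
- by rewrite cD wcomp_nabla_D // mem_cat inE eqxx orbT.
apply: (addrI (wcomp (hv_word a b ++ H :: V :: v) k l c)).
rewrite cS IHm ?wcomp_nabla_swap //.
by move: wm; rewrite inversions_swap.
Qed.

Lemma nabla_imageS n (c : sh n.+1) :
    (forall a b v k l, wcomp (hv_word a b ++ D :: v) k l c = 0) ->
    (forall a b v k l, wcomp (hv_word a b ++ D :: v) k l (zcx_d sh n c) = 0) ->
  exists t, c = nabla n.+1 t.
Proof.
move=> cD dcD; apply: nabla_image => // a b v k l.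
have := dcD a b v k l; rewrite wcomp_d_diag ?hv_word_noD //.
move/eqP; rewrite -signr_odd; case: (odd _).
  by rewrite expr1 mulrN1z oppr_eq0 => /eqP.
by rewrite expr0 mulr1z => /eqP.
Qed.

Lemma nabla_image_cycle n (c : sh n) :
    (forall a b v k l, wcomp (hv_word a b ++ D :: v) k l c = 0) ->
    c \in @is_cycle sh n ->
  exists t, c = nabla n t.
Proof.
case: n c => [|n] c cD dc.
  apply: nabla_image => // a b v k l.
  (* In degree 0 the only word is the empty one. *)
  by rewrite !wcomp0 ?addr0 // !size_cat /= addnS.
by apply: nabla_imageS => // a b v k l; rewrite (eqP dc) raddf0.
Qed.

End Nabla.

(** * Passage to homology and naturality *)

Lemma quasi_isoP (C C' : zcomplex) (f : zmorph C C') :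
    (forall n t u, f n t = zcx_d C' n u -> exists s, t = zcx_d C n s) ->
    (forall n (z : cycles C' n), exists (t : cycles C n) u,
       cycle_val z - f n (cycle_val t) = zcx_d C' n u) ->
  quasi_iso f.
Proof.
move=> f_inj f_surj n.
have classE (E : zcomplex) (h : homology E n) :
  homology_class (repr h) = h by rewrite /homology_class reprK.
have hmap_inj : injective (homology_map f (n := n)).
  move=> g h; rewrite -(classE _ g) -(classE _ h) !homology_map_class.
  move=> /homology_classP[u /=]; rewrite -raddfB => /f_inj[s ts].
  by apply/homology_classP; exists s.
have hmap_surj (h : homology C' n) : exists g, homology_map f g = h.
  have [t [u zu]] := f_surj n (repr h); exists (homology_class t).
  rewrite homology_map_class -(classE _ h); apply/homology_classP.
  by exists (- u); rewrite raddfN -zu opprB.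
have [g gK] := choice hmap_surj.
by exists g => // h; apply: hmap_inj; rewrite gK.
Qed.

Lemma nabla_quasi_iso (R : pzRingType) (X : complex R^c) (Y : complex R) :
  quasi_iso (nabla X Y).
Proof.
pose sh := shuffle_complex X Y.
have cycle_d n u : zcx_d sh n u \in @is_cycle sh n.
  by case: n u => // n u; apply/eqP/zcx_dd.
apply: quasi_isoP => [n t u tu|n [z zc]].
  (* The correction does not change the differential of [u], which lies in the image of [nabla] and
     so has no component at words with D. *)
  have [u' u'D] := kill_diag u.
  have du' : zcx_d sh n (u - zcx_d sh n.+1 u') = nabla X Y n t.
    by rewrite raddfB zcx_dd subr0.
  have [//|a b v k l|s us] := @nabla_imageS _ X Y n (u - zcx_d sh n.+1 u').
    by rewrite du' wcomp_nabla_D // mem_cat inE eqxx orbT.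
  by exists s; apply: (@nabla_inj _ X Y n); rewrite -du' us zm_d.
have [u uD] := kill_diag z.
have z'c : z - zcx_d sh n u \in @is_cycle sh n.
  by apply: rpredB => //; exact: cycle_d.
have [t zt] := nabla_image_cycle uD z'c.
(* [nabla] is an injective chain map, so the preimage of a cycle is a cycle. *)
have tc : t \in @is_cycle (tensor_complex X Y) n.
  case: n z zc u {uD} z'c t zt => // n z zc u z'c t zt.
  apply/eqP/(@nabla_inj _ X Y n).
  by rewrite zm_d -zt (eqP z'c) raddf0.
exists (Cycle tc), u; rewrite [cycle_val _]/= -[nabla X Y n _]zt.
exact: subKr.
Qed.

Lemma nabla_natural (R : pzRingType) (X X' : complex R^c) (Y Y' : complex R)
    (eta : cxmorph X X') (theta : cxmorph Y Y') n (t : tensor_complex X Y n) :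
  nabla X' Y' n (tensor_complex_map eta theta n t) =
  shuffle_complex_map eta theta n (nabla X Y n t).
Proof.
apply/dsumP => p; rewrite !ffunE raddfMz /=; congr (_ *~ _).
move: (nat_of_ord (dtgt (shl p))) (nat_of_ord (dtgt (shr p))) => k l.
have [/eqP kl|kl] := eqVneq (k + l)%N n; last by rewrite !tcomp0 ?raddf0.
rewrite -[k]/(bdl (Bideg kl)) -[l]/(bdr (Bideg kl)) !tcomp_bideg.
by rewrite ffunE.
Qed.

Theorem theorem5p9 (R : pzRingType) :
  exists nabla : forall (X : complex R^c) (Y : complex R),
      zmorph (tensor_complex X Y) (shuffle_complex X Y),
    [/\ forall (X : complex R^c) (Y : complex R), quasi_iso (nabla X Y),
        forall (X X' : complex R^c) (Y : complex R) (eta : cxmorph X X')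
            (n : nat) (t : tensor_complex X Y n),
          nabla X' Y n (tensor_complex_map eta (cxid Y) n t) =
          shuffle_complex_map eta (cxid Y) n (nabla X Y n t)
      & forall (X : complex R^c) (Y Y' : complex R) (theta : cxmorph Y Y')
            (n : nat) (t : tensor_complex X Y n),
          nabla X Y' n (tensor_complex_map (cxid X) theta n t) =
          shuffle_complex_map (cxid X) theta n (nabla X Y n t)].
Proof.
exists (@nabla R); split=> *; first exact: nabla_quasi_iso;
  exact: nabla_natural.
Qed.
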